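(* Let $X$ and $Y$ be symmetric spaces on $[0,1]$ such that $X\subseteq Y$. If the Kruglov operator $K$ acts boundedly from $X$ into $Y$, then there exists a universal constant $\beta>0$ such that for every sequence $\mathbf f=\{f_k\}_{k=1}^\infty\subset X$ of independent random variables and for every $q\in[1,\infty]$, $$\|\mathbf f\|_{Y(l_q)}\le\beta\,\|K\|_{X\to Y}^{1/q}\,\|F\|_{Z_X^q},$$ where $F$ is the disjointification of $\mathbf f$.
   Context: $\lambda$ is Lebesgue measure; random variables are measurable functions on $([0,1],\lambda)$. For a measurable function $f$, $f^*$ denotes the decreasing rearrangement of $|f|$. A symmetric space $X$ on an interval $I$ ($I=[0,1]$ or $(0,\infty)$) is a Banach space of measurable functions on $I$ such that $f\in X$ and $g^*\le f^*$ imply $g\in X$ and $\|g\|_X\le\|f\|_X$; always normalized by $\|\chi_{(0,1)}\|_X=1$. Disjointification: $F:=\sum_k\bar f_k$ on $(0,\infty)$, where the $\bar f_k$ have pairwise disjoint supports and $\bar f_k$ is equimeasurable with $f_k$ (e.g. $F(t)=\sum_k f_k(t-k+1)\chi_{[k-1,k]}(t)$). For $q\in[1,\infty]$, $\|f\|_{Z_X^q}:=\|f^*\chi_{[0,1]}\|_X+\|f\|_{(L_1+L_q)(0,\infty)}$ for $f\in (L_1+L_\infty)(0,\infty)$ (the value $+\infty$ is allowed, in which case the estimate is vacuous); this norm is equivalent to the quasi-norm $\|f^*\chi_{[0,1]}\|_X+\|f^*\chi_{[1,\infty)}\|_{L_q}$. Also $$\|\mathbf f\|_{Y(l_q)}:=\sup_{n}\Bigl\|\Bigl(\sum_{k=1}^n|f_k|^q\Bigr)^{1/q}\Bigr\|_Y,$$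 with the obvious modification ($\max_{k\le n}|f_k|$) for $q=\infty$; $1/q=0$ for $q=\infty$. Kruglov operator: let $\{B_n\}_{n\ge1}$ be pairwise disjoint measurable subsets of $[0,1]$ with $\lambda(B_n)=\frac1{e\,n!}$, and let $(\Omega,\mathcal P)=\prod_{n=0}^\infty([0,1],\lambda_n)$ with each $\lambda_n$ Lebesgue measure on $[0,1]$. For $f\in L_1[0,1]$, $$Kf(\omega_0,\omega_1,\dots)=\sum_{n=1}^\infty\sum_{k=1}^n f(\omega_k)\chi_{B_n}(\omega_0).$$ $K$ is a positive linear operator $L_1[0,1]\to L_1(\Omega,\mathcal P)$. For a symmetric space $Y$ on $[0,1]$, $\|Kf\|_Y$ means $\|(Kf)^*\|_Y$; $K$ acts boundedly from $X$ into $Y$ if $\|K\|_{X\to Y}:=\sup_{\|f\|_X\le1}\|Kf\|_Y<\infty$.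
   Formalization: The constant β is not absolute: it may depend on X and Y, but only through the norm of the inclusion X ⊆ Y (one β serves all inclusions of norm 1). A β independent of X and Y is impossible, e.g. X=L_2, ‖f‖_Y=√N‖f*χ_[0,1/N]‖_2, q=∞. Measurable functions are taken Borel. *)

(* Defs.v *)
From HB Require Import structures.
From mathcomp Require Import all_boot all_order all_algebra.
From mathcomp Require Import finmap.
From mathcomp Require Import all_classical all_reals all_analysis.

Set Implicit Arguments.
Unset Strict Implicit.
Unset Printing Implicit Defensive.

Import Order.TTheory GRing.Theory Num.Theory.
Import numFieldNormedType.Exports.

Local Open Scope classical_set_scope.
Local Open Scope ring_scope.

Definition unit_interval (R : realType) : set R := `[0, 1]%classic.
Definition half_line (R : realType) : set R := `]0, +oo[%classic.
Arguments unit_interval : clear implicits.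
Arguments half_line : clear implicits.

(* Functions are only looked at on their domain [D]: what they do outside [D]
   is irrelevant, so a function on [0, 1] or (0, +oo) is a term of [R -> R]. *)

Definition distribution_function d (T : measurableType d) (R : realType)
    (mu : set T -> \bar R) (D : set T) (f : T -> R) (s : R) : \bar R :=
  mu (D `&` [set x | s < `|f x|]).

Definition rearrangement d (T : measurableType d) (R : realType)
    (mu : set T -> \bar R) (D : set T) (f : T -> R) (t : R) : \bar R :=
  ereal_inf [set s%:E | s in
    [set s : R | 0 <= s /\ (distribution_function mu D f s <= t%:E)%E]].

(* Elements are represented by real-valued functions rather than by classes
   modulo a.e. equality on [I]: by [ss_symm], [ss_mem] and [ss_norm] are
   invariant under a.e. equality. The value of the rearrangement at 0, which
   may be infinite for unbounded functions, is not compared. *)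
Record symmetric_space (R : realType) (I : set R) := SymmetricSpace {
  ss_mem : set (R -> R) ;
  ss_norm : (R -> R) -> R ;
  ss_measurable : forall f, ss_mem f -> measurable_fun I f ;
  ss_add : forall f g, ss_mem f -> ss_mem g -> ss_mem (f \+ g) ;
  ss_scale : forall (a : R) f, ss_mem f -> ss_mem (a \*o f) ;
  ss_norm_eq0 : forall f, ss_mem f ->
    (ss_norm f = 0 <-> {ae lebesgue_measure, forall x, I x -> f x = 0}) ;
  ss_norm_scale : forall (a : R) f, ss_mem f ->
    ss_norm (a \*o f) = `|a| * ss_norm f ;
  ss_norm_triangle : forall f g, ss_mem f -> ss_mem g ->
    ss_norm (f \+ g) <= ss_norm f + ss_norm g ;
  ss_complete : forall u : nat -> R -> R, (forall n, ss_mem (u n)) ->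
    (forall e : R, 0 < e -> exists N : nat, forall m n : nat,
      (N <= m)%N -> (N <= n)%N -> ss_norm (u m \- u n) < e) ->
    exists2 f, ss_mem f & (fun n => ss_norm (u n \- f)) @ \oo --> (0 : R) ;
  ss_symm : forall f g, ss_mem f -> measurable_fun I g ->
    (forall t : R, 0 < t ->
      (rearrangement lebesgue_measure I g t
        <= rearrangement lebesgue_measure I f t)%E) ->
    ss_mem g /\ ss_norm g <= ss_norm f ;
  ss_mem_unit : ss_mem \1_`]0, 1[%classic ;
  ss_norm_unit : ss_norm \1_`]0, 1[%classic = 1
}.

(* +oo on functions outside X, or infinite on a non-null subset of I. *)
Definition ext_norm (R : realType) (I : set R) (X : symmetric_space I)
    (g : R -> \bar R) : \bar R :=
  if `[< {ae lebesgue_measure, forall x, I x -> g x \is a fin_num}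
         /\ ss_mem X (fine \o g) >]
  then (ss_norm X (fine \o g))%:E else +oo%E.

Definition unit_ball (R : realType) (I : set R) (X : symmetric_space I) :
    set (R -> R) :=
  [set f | ss_mem X f /\ ss_norm X f <= 1].

Definition inclusion_norm (R : realType) (I : set R)
    (X Y : symmetric_space I) : \bar R :=
  ereal_sup [set ext_norm Y (EFin \o f) | f in unit_ball X].

Definition independent_rvs (R : realType) (f : nat -> R -> R) : Prop :=
  forall (J : {fset nat}) (A : nat -> set R), (forall k, measurable (A k)) ->
    lebesgue_measure (unit_interval R `&`
      \bigcap_(k in [set` J]) (f k @^-1` A k))
    = (\prod_(k <- J) lebesgue_measure (unit_interval R `&` f k @^-1` A k))%E.

Definition equimeasurable (R : realType) (D E : set R) (f g : R -> R) : Prop :=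
  forall s : R, 0 <= s ->
    distribution_function lebesgue_measure D f s
    = distribution_function lebesgue_measure E g s.

(* Any disjoint realization is allowed, e.g. translates of the [f k] to the
   intervals (k, k + 1); [F] is only fixed almost everywhere. At most
   one [fbar k t] is nonzero, so the sum is an eventually constant limit. *)
Definition disjointification (R : realType) (f : nat -> R -> R)
    (F : R -> R) : Prop :=
  measurable_fun (half_line R) F /\
  exists fbar : nat -> R -> R,
    [/\ forall k, measurable_fun (half_line R) (fbar k),
        trivIset setT (fun k => half_line R `&` [set t | fbar k t != 0]),
        forall k, equimeasurable (half_line R) (unit_interval R) (fbar k) (f k)
      & {ae lebesgue_measure, forall t, half_line R t ->
          F t = \big[+%R/0]_(0 <= k <oo) fbar k t}].

Definition L1_plus_Lq_norm (R : realType) (D : set R) (q : \bar R)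
    (f : R -> R) : \bar R :=
  ereal_inf [set ('N[lebesgue_measure]_1[(EFin \o gh.1) \_ D]
                  + 'N[lebesgue_measure]_q[(EFin \o gh.2) \_ D])%E
    | gh in [set gh : (R -> R) * (R -> R) |
        [/\ measurable_fun D gh.1, measurable_fun D gh.2
          & forall t, D t -> f t = gh.1 t + gh.2 t]]].

Definition Z_norm (R : realType) (X : symmetric_space (unit_interval R))
    (q : \bar R) (F : R -> R) : \bar R :=
  (ext_norm X ((rearrangement lebesgue_measure (half_line R) F)
                 \_ (unit_interval R))
   + L1_plus_Lq_norm (half_line R) q F)%E.

Definition lq_sum (R : realType) (q : \bar R) (f : nat -> R -> R) (n : nat)
    (x : R) : R :=
  match q with
  | r%:E => (\sum_(k < n) `|f k x| `^ r) `^ r^-1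
  | _ => \big[Num.max/0]_(k < n) `|f k x|
  end.

Definition Ylq_norm (R : realType) (Y : symmetric_space (unit_interval R))
    (q : \bar R) (f : nat -> R -> R) : \bar R :=
  ereal_sup [set ext_norm Y (EFin \o lq_sum q f n.+1) | n in [set: nat]].

Definition cylinders (R : realType) : set (set (nat -> R)) :=
  [set C | exists k : nat, exists2 A : set R, measurable A &
    C = [set w | A (w k)]].
Arguments cylinders : clear implicits.

Definition sequence_space (R : realType) :=
  g_sigma_algebraType (cylinders R).

Definition cube (R : realType) : set (nat -> R) :=
  [set w | forall k, unit_interval R (w k)].
Arguments cube : clear implicits.

(* The infinite power of Lebesgue measure on [0, 1], which is carried by
   [cube R]; it is determined by its values on finite rectangles. *)
Definition is_product_measure (R : realType)
    (P : probability (sequence_space R) R) : Prop :=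
  forall (n : nat) (A : nat -> set R), (forall k, measurable (A k)) ->
    P [set w | forall k, (k < n)%N -> A k (w k)]
    = (\prod_(k < n) lebesgue_measure (unit_interval R `&` A k))%E.

(* Only the sets [B n] with [n >= 1] are used. *)
Definition kruglov_sets (R : realType) (B : nat -> set R) : Prop :=
  [/\ forall n, (0 < n)%N -> measurable (B n) /\ B n `<=` unit_interval R,
      trivIset [set n | (0 < n)%N] B
    & forall n, (0 < n)%N ->
        lebesgue_measure (B n) = ((expR 1 * n`!%:R)^-1)%:E].

(* At most one summand over [n] is nonzero, so this real limit exists. *)
Definition kruglov (R : realType) (B : nat -> set R) (f : R -> R)
    (w : nat -> R) : R :=
  \big[+%R/0]_(1 <= n <oo)
    \sum_(1 <= k < n.+1) f (w k) * \1_(B n) (w 0%N).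

Definition kruglov_norm (R : realType) (P : probability (sequence_space R) R)
    (B : nat -> set R) (X Y : symmetric_space (unit_interval R)) : \bar R :=
  ereal_sup [set ext_norm Y (rearrangement P (cube R) (kruglov B f))
    | f in unit_ball X].

(* Main.v *)
Require Import Defs.
From HB Require Import structures.
From mathcomp Require Import all_boot all_order all_algebra.
From mathcomp Require Import finmap ring lra zify.
From mathcomp Require Import all_classical all_reals all_analysis.
From mathcomp Require Import measurable_realfun.

Set Implicit Arguments.
Unset Strict Implicit.
Unset Printing Implicit Defensive.

Import Order.TTheory GRing.Theory Num.Theory.
Import numFieldNormedType.Exports.

Local Open Scope classical_set_scope.
Local Open Scope ring_scope.

(** Fix a real number [z] above the norm of [F] in [Z_X^q]. It is enough to bound
    the norm of [(\sum_(k < n) |f_k| ^ q) ^ (1 / q)] in [Y] by a multiple of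
    [|K| ^ (1 / q) * z], and then to let [z] decrease.

    Cut every [|f_k|] at the level [z]. The rearrangement [V] of [F] has norm less
    than [z] in [X], so that the tail of [F] at [z] is at most [1]
    ([distribution_le1]): above [z], the tails of the [f_k] add up to the tail of
    [V] on the unit interval ([large_part_cell]). Below [z], a decomposition of [F]
    in [L_1 + L_q] shows that the variables [zeta_k = (min |f_k| z / (4 z)) ^ q]
    have expectations of sum at most [1] ([small_part_mean]).

    The case [q = 1] carries the probabilistic content. The large values
    [g_k = |f_k| 1_{|f_k| > z}] satisfy [P (\sum g_k > s) <= 4 P (K V > s / 2)]
    ([sum_tail_le_kruglov]). Expand the event according to the set of indices at
    which [g_k] is nonzero. A set of [m] indices contributes at most the product of
    the laws of these [g_k], and the [m]-subsets together contribute at most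
    [1 / m!] times the [m]-th power of the sum of all the laws, that is, of the law
    of [V]; but [K V] is a sum of [m] independent copies of [V] with probability
    [1 / (e * m!)]. After a discretization this is a coefficientwise inequality
    between polynomials, [\prod (1 + q_k) <= exp (\sum q_k)]. In the same way
    [P (\sum zeta_k > s) <= 4 P (K 1 > s / 7)]
    ([bounded_sum_tail_le_kruglov]), by Chernoff's bound for the left-hand side and
    because [K 1] is a Poisson variable. A bound of tails by a multiple of tails
    costs only a constant in a symmetric space ([ss_dilation]).

    For [q = +oo] one only needs that the maximum of the [g_k] has a smaller tail
    than [V], so that its norm is at most [c * z], where [c] is the norm of the
    inclusion of [X] into [Y]. The remaining exponents are interpolated: with
    [theta = 1 / q],
      [(\sum g_k ^ q) ^ theta <= (max g_k) ^ (1 - theta) * (\sum g_k) ^ theta]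
    and
      [(\sum zeta_k) ^ theta = 1 ^ (1 - theta) * (\sum zeta_k) ^ theta],
    and the norm of a product of this shape is controlled by the corresponding
    powers of the norms, through Young's inequality in the form
    [s ^ (1 - theta) * t ^ theta <= s + t]. The constant depends on [X] and [Y]
    through [c] only, which is finite because [K f] contains, with probability
    [1 / e], a copy of [f] ([inclusion_norm_le]). *)

(** * Poissonization of products of generating polynomials *)

Section poissonization.
Variable R : realType.
Implicit Types (p q : {poly R}) (n m M N L : nat).

Local Notation nneg_poly := (polyOver (@Num.Def.nneg_num_pred R)).

Lemma nneg_polyMX p q n : p \is a nneg_poly -> q \is a nneg_poly ->
  p - q \is a nneg_poly -> p ^+ n - q ^+ n \is a nneg_poly.
Proof.
move=> p0 q0 pq0; rewrite subrXX rpredM// rpred_sum// => i _.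
by rewrite rpredM// rpredX.
Qed.

Lemma nneg_polyZ (a : R) p : 0 <= a -> p \is a nneg_poly ->
  a *: p \is a nneg_poly.
Proof. by move=> a0 p0; apply: polyOverZ. Qed.

Definition exp_poly n p : {poly R} := \sum_(m < n.+1) (m`!%:R)^-1 *: p ^+ m.

Lemma exp_poly_nneg n p : p \is a nneg_poly -> exp_poly n p \is a nneg_poly.
Proof.
move=> p0; apply: rpred_sum => m _.
by rewrite nneg_polyZ ?invr_ge0// rpredX.
Qed.

(** The two lowest terms in [q] of the binomial expansion already suffice:
    [(p + q) ^ m >= p ^ m + m * (p ^ (m - 1) * q)] coefficientwise. *)
Lemma exp_poly_add n p q : p \is a nneg_poly -> q \is a nneg_poly ->
  exp_poly n.+1 (p + q) - exp_poly n p * (1 + q) \is a nneg_poly.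
Proof.
move=> p0 q0.
have -> : exp_poly n p * (1 + q) = 1 +
    (\sum_(m < n.+1) ((m.+1)`!%:R)^-1 *: (p ^+ m.+1 + (p ^+ m * q) *+ m.+1))
    - ((n.+1)`!%:R)^-1 *: p ^+ n.+1.
  under eq_bigr do rewrite scalerDr; rewrite big_split/=.
  rewrite mulrDr mulr1 {1}/exp_poly big_ord_recl fact0 invr1 scale1r expr0.
  rewrite [X in _ = 1 + (X + _) - _]big_ord_recr/= -!addrA; congr (_ + _).
  congr (_ + _); rewrite [RHS]addrC -addrA addNr addr0.
  rewrite mulr_suml; apply: eq_bigr => m _; rewrite -scalerAl.
  rewrite -[_ *+ m.+1 in RHS]scaler_nat scalerA factS natrM invfM; congr (_ *: _).
  by rewrite mulrAC mulVf ?mul1r// pnatr_eq0.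
rewrite {1}/exp_poly big_ord_recl fact0 invr1 scale1r expr0.
rewrite opprD opprK [- (_ + _)]opprD !addrA [1 + _ - 1]addrAC subrr add0r.
rewrite rpredD//; last by rewrite nneg_polyZ ?invr_ge0// rpredX.
rewrite -sumrB rpred_sum// => m _; rewrite -scalerBr nneg_polyZ ?invr_ge0//.
rewrite /= /bump/= add1n exprDn 2!big_ord_recl/= /bump/= !subn0 !expr0 mulr1.
rewrite bin0 mulr1n addn0 bin1 subSS subn0 expr1 addrA [X in X - _]addrC addrK.
rewrite rpred_sum// => i _; rewrite rpredMn// rpredM// rpredX//.
Qed.

(** The coefficientwise form of [\prod (1 + q_k) <= exp (\sum q_k)], by
    induction on [n] with [exp_poly_add]. When [a k + q k] generates the law of
    a nonnegative integer variable, the left-hand side generates the law of the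
    sum of [n] independent ones, and the right-hand side is, up to the factor
    [exp (- 1)], a truncated compound Poisson law. *)
Lemma prod_le_exp_poly n (a : nat -> R) (q : nat -> {poly R}) :
  (forall k, 0 <= a k <= 1) -> (forall k, q k \is a nneg_poly) ->
  exp_poly n (\sum_(k < n) q k) - \prod_(k < n) ((a k)%:P + q k)
    \is a nneg_poly.
Proof.
move=> a01 q0; elim: n => [|n ih].
  by rewrite !big_ord0 /exp_poly big_ord1 fact0 invr1 scale1r expr0 subrr rpred0.
rewrite !big_ord_recr/=.
set S := \sum_(k < n) q k; set P := \prod_(k < n) _.
have S0 : S \is a nneg_poly by exact: rpred_sum.
have -> : exp_poly n.+1 (S + q n) - P * ((a n)%:P + q n) =
  (exp_poly n.+1 (S + q n) - exp_poly n S * (1 + q n))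
  + exp_poly n S * (1 - (a n)%:P)
  + (exp_poly n S - P) * ((a n)%:P + q n).
  ring.
have /andP[an0 an1] := a01 n.
rewrite rpredD//; first rewrite rpredD ?exp_poly_add//.
  by rewrite rpredM ?exp_poly_nneg// -polyCB polyOverC nnegrE subr_ge0.
by rewrite rpredM// rpredD// polyOverC.
Qed.

Definition law_poly L (w : nat -> R) : {poly R} := \sum_(j < L.+1) w j *: 'X^j.

Lemma law_poly_nneg L w : (forall j, 0 <= w j) -> law_poly L w \is a nneg_poly.
Proof.
by move=> w0; apply: rpred_sum => j _; rewrite nneg_polyZ// rpredX// polyOverX.
Qed.

Lemma prod_law_poly L n (w : nat -> nat -> R) :
  \prod_(k < n) law_poly L (w k) =
  \sum_(v : {ffun 'I_n -> 'I_L.+1})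
    (\prod_(k < n) w k (v k)) *: 'X^(\sum_(k < n) v k).
Proof.
rewrite bigA_distr_bigA; apply: eq_bigr => v _.
by rewrite scaler_prod -expr_sum.
Qed.

(** The bound [N], larger than every degree that occurs, makes the tail linear
    in [p]. *)
Definition tail_sum N M p : R := \sum_(i < N | (M < i)%N) p`_i.

Lemma tail_sum_is_linear N M : linear (tail_sum N M).
Proof.
move=> a p q; rewrite /tail_sum.
under eq_bigr do rewrite coefD coefZ.
by rewrite big_split/= scaler_sumr.
Qed.

HB.instance Definition _ N M :=
  GRing.isLinear.Build R {poly R} R *%R (tail_sum N M) (tail_sum_is_linear N M).

Lemma ler_tail_sum N M p q : q - p \is a nneg_poly ->
  tail_sum N M p <= tail_sum N M q.
Proof.
move=> /polyOverP qp; rewrite /tail_sum ler_sum// => i _.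
by have := qp i; rewrite coefB nnegrE subr_ge0.
Qed.

Lemma tail_sumXn N M i : (i < N)%N -> tail_sum N M 'X^i = (M < i)%N%:R.
Proof.
move=> iN; rewrite /tail_sum; under eq_bigr do rewrite coefXn.
case: ltnP => Mi.
  rewrite (bigD1 (Ordinal iN))//= eqxx big1 ?addr0// => j /andP[_].
  by rewrite -val_eqE/= => /negbTE ->.
rewrite big1// => j Mj.
by case: eqP => // ji; move: Mj; rewrite ji ltnNge Mi.
Qed.

Lemma tail_sum_prod_law L n N M (w : nat -> nat -> R) : (n * L < N)%N ->
  tail_sum N M (\prod_(k < n) law_poly L (w k)) =
  \sum_(v : {ffun 'I_n -> 'I_L.+1} | (M < \sum_(k < n) v k)%N)
    \prod_(k < n) w k (v k).
Proof.
move=> nLN; rewrite prod_law_poly linear_sum/= [RHS]big_mkcond/=.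
apply: eq_bigr => v _; rewrite linearZ/= tail_sumXn; last first.
  apply: leq_ltn_trans nLN; rewrite -[n in (n * _)%N]card_ord -sum_nat_const.
  by apply: leq_sum => k _; rewrite -ltnS.
by case: ifP => _; rewrite ?mulr1 ?mulr0.
Qed.

(** Both sides are tails of product polynomials; the constant coefficients of
    the left factors are at most [1], and the remaining coefficients add up to
    at most those of [r]. *)
Lemma poisson_domination L n M (w : nat -> nat -> R) (r : nat -> R) :
  (forall k j, 0 <= w k j) -> (forall k, w k 0%N <= 1) ->
  (forall j, 0 <= r j) ->
  (forall j, (0 < j <= L)%N -> \sum_(k < n) w k j <= r j) ->
  \sum_(v : {ffun 'I_n -> 'I_L.+1} | (M < \sum_(k < n) v k)%N)
    \prod_(k < n) w k (v k) <=
  \sum_(m < n.+1) (m`!%:R)^-1 *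
    \sum_(v : {ffun 'I_m -> 'I_L.+1} | (M < \sum_(k < m) v k)%N)
      \prod_(k < m) r (v k).
Proof.
move=> w0 w1 r0 wr; pose N := (n * L).+1.
rewrite -(@tail_sum_prod_law _ _ N)//.
pose jumps (u : nat -> R) := \sum_(j < L) u j.+1 *: 'X^(j.+1) : {poly R}.
have lawE u : law_poly L u = (u 0%N)%:P + jumps u.
  by rewrite /law_poly big_ord_recl/= expr0 alg_polyC.
have jumps0 u : (forall j, 0 <= u j) -> jumps u \is a nneg_poly.
  move=> u0; apply: rpred_sum => j _.
  by rewrite nneg_polyZ// rpredX// polyOverX.
under eq_bigr do rewrite lawE.
apply: le_trans (ler_tail_sum _ _ (@prod_le_exp_poly n
  (fun k => w k 0%N) (fun k => jumps (w k)) _ _)) _.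
- by move=> k; rewrite w0 w1.
- by move=> k; exact: jumps0.
rewrite /exp_poly linear_sum/=; apply: ler_sum => m _.
rewrite linearZ/= ler_wpM2l ?invr_ge0//.
rewrite -(@tail_sum_prod_law _ _ N _ (fun=> r)); last first.
  by rewrite ltnS leq_mul2r -ltnS ltn_ord orbT.
rewrite prodr_const card_ord; apply: ler_tail_sum; apply: nneg_polyMX.
- exact: law_poly_nneg.
- by apply: rpred_sum => k _; exact: jumps0.
rewrite lawE -addrA rpredD ?polyOverC//; first exact: r0.
rewrite /jumps/= exchange_big/= -sumrB rpred_sum// => j _.
rewrite -scaler_suml -scalerBl nneg_polyZ ?rpredX ?polyOverX//.
by rewrite subr_ge0; apply: wr; rewrite /= ltn_ord.
Qed.

End poissonization.

(** * Grid levels and the laws of sums of independent variables *)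

Section level.
Variable R : realType.
Implicit Types (delta y : R) (L j : nat).

(** A rounding down of [y / delta] that is capped at [L], so that only finitely
    many values occur. *)
Definition level delta L y : nat :=
  (\sum_(j < L) (j.+1%:R * delta < y)%R)%N.

Lemma level_le delta L y : (level delta L y <= L)%N.
Proof.
rewrite -{2}(card_ord L) -sum1_card; apply: leq_sum => i _.
by case: (_ < _).
Qed.

Lemma ltn_level delta L y j : 0 <= delta ->
  (j < level delta L y)%N = (j < L)%N && (j.+1%:R * delta < y).
Proof.
move=> d0; rewrite /level; elim: L j => [|L ih] j; first by rewrite big_ord0.
rewrite big_ord_recr/=; case: (ltrP (L.+1%:R * delta) y) => Ly /=.
  have dy i : (i <= L)%N -> i.+1%:R * delta < y.
    by move=> iL; apply: le_lt_trans Ly; rewrite ler_wpM2r// ler_nat.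
  rewrite (eq_bigr (fun=> 1%N)) ?sum1_card ?card_ord ?addn1.
    by case: (ltnP j L.+1) => //= jL; rewrite dy.
  by move=> i _; rewrite dy//; exact: ltnW.
rewrite addn0 ih ltnS [in RHS]leq_eqVlt; case: eqP => [->|_]//=.
by rewrite ltnn/= ltNge Ly.
Qed.

Lemma level_mul_le delta L y : 0 <= delta -> 0 <= y ->
  (level delta L y)%:R * delta <= y.
Proof.
move=> d0 y0; case E : (level _ _ _) => [|j]; first by rewrite mul0r.
by have := ltn_level L y j d0; rewrite E ltnSn => /esym/andP[_ /ltW].
Qed.

Lemma le_level_mul delta L y : 0 <= delta -> (level delta L y < L)%N ->
  y <= (level delta L y).+1%:R * delta.
Proof.
move=> d0 lL; have := ltn_level L y (level delta L y) d0.
by rewrite ltnn lL/= => /esym/negbT; rewrite -leNgt.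
Qed.

(** The sets on which [level] takes a given nonzero value; the top one, where the
    cap acts, has [b = +oo]. *)
Definition cell (a : R) (b : \bar R) : set R :=
  [set y | (a < y) /\ (y%:E <= b)%E].

Lemma level_cell delta L j : 0 <= delta -> (0 < j <= L)%N ->
  level delta L @^-1` [set j] =
  cell (j%:R * delta) (if (j < L)%N then (j.+1%:R * delta)%:E else +oo%E).
Proof.
move=> d0 /andP[j0 jL]; apply/seteqP; split => y /=.
  move=> ly; split.
    have := ltn_level L y j.-1 d0.
    by rewrite prednK// ly leqnn => /esym/andP[].
  case: ltnP => jL'; last by rewrite leey.
  by rewrite lee_fin -ly; apply: le_level_mul => //; rewrite ly.
move=> [jy yj]; apply/eqP; rewrite eqn_leq; apply/andP; split.
  rewrite leqNgt ltn_level// negb_and; move: yj; case: (ltnP j L) => //=.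
  by rewrite lee_fin -leNgt.
by have := ltn_level L y j.-1 d0; rewrite prednK// jy jL/= => ->.
Qed.

Lemma measurable_cell a b : measurable (cell a b).
Proof.
have -> : cell a b = [set` `]a, +oo[] `&` [set y | (y%:E <= b)%E].
  apply/seteqP; split => y /=; rewrite in_itv/= andbT//.
apply: measurableI; first exact: measurable_itv.
case: b => [b| |].
- rewrite (_ : [set y | _] = [set` `]-oo, b]]); first exact: measurable_itv.
  by apply/seteqP; split => y /=; rewrite in_itv.
- rewrite (_ : [set y | _] = setT); first exact: measurableT.
  by apply/seteqP; split => y //= _; rewrite leey.
- rewrite (_ : [set y | _] = set0); first exact: measurable0.
  by apply/seteqP; split => y //=; rewrite leeNy_eq.
Qed.

Lemma measurable_level delta L j : 0 <= delta ->
  measurable (level delta L @^-1` [set j]).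
Proof.
move=> d0; have [/andP[]|] := boolP (0 < j <= L)%N.
  by move=> *; rewrite level_cell//; [exact: measurable_cell|exact/andP].
rewrite negb_and -leqNgt leqn0 -ltnNge => /orP[/eqP ->|Lj].
  case: (posnP L) => [L0|L0].
    rewrite (_ : _ @^-1` _ = setT); first exact: measurableT.
    apply/seteqP; split => y //= _.
    by have := level_le delta L y; rewrite L0 leqn0 => /eqP.
  rewrite (_ : _ @^-1` _ = [set` `]-oo, delta]]); first exact: measurable_itv.
  apply/seteqP; split => y /=; rewrite in_itv/= => Hy.
    by have := @le_level_mul delta L y d0; rewrite Hy mul1r; apply.
  apply/eqP; rewrite -leqn0 leqNgt ltn_level// L0/= mul1r.
  by rewrite -leNgt.
rewrite (_ : _ @^-1` _ = set0); first exact: measurable0.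
apply/seteqP; split => y //= ly.
by have := level_le delta L y; rewrite ly leqNgt Lj.
Qed.

End level.

Section finite_unions.
Context d (T : measurableType d) (R : realType) (mu : {measure set T -> \bar R}).

Lemma measure_le_sum (I : Type) (s : seq I) (P : pred I) (F : I -> set T) :
  (forall i, P i -> measurable (F i)) ->
  (mu (\big[setU/set0]_(i <- s | P i) F i) <= \sum_(i <- s | P i) mu (F i))%E.
Proof.
move=> mF; suff : measurable (\big[setU/set0]_(i <- s | P i) F i) /\
   (mu (\big[setU/set0]_(i <- s | P i) F i) <= \sum_(i <- s | P i) mu (F i))%E.
  by case.
elim: s => [|i s [mU ih]]; first by rewrite !big_nil measure0; split.
rewrite !big_cons; case: ifP => // Pi; split.
  by apply: measurableU => //; exact: mF.
by apply: (le_trans (measureU2 _ _ _)) => //; [exact: mF|rewrite leeD2l].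
Qed.

(** Disjointness is only asked of the indices that satisfy [P]: this serves sums
    indexed by jumps, by levels and by the summands of a disjointification. *)
Lemma sum_measure_le (I : eqType) (s : seq I) (P : pred I) (F : I -> set T)
    (E : set T) :
  uniq s -> measurable E -> (forall i, P i -> measurable (F i)) ->
  (forall i, P i -> F i `<=` E) ->
  (forall i j x, P i -> P j -> F i x -> F j x -> i = j) ->
  (\sum_(i <- s | P i) mu (F i) <= mu E)%E.
Proof.
move=> us mE mF FE Fdisj.
have {FE} : forall i x, i \in s -> P i -> F i x -> E x.
  by move=> i x _ Pi Fx; exact: FE Fx.
elim: s us E mE => [|i s ih] /=; first by move=> *; rewrite big_nil.
move=> /andP[is_ us] E mE FE; rewrite big_cons; case: ifP => Pi; last first.
  by apply: ih => // j x js; apply: FE; rewrite in_cons js orbT.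
rewrite (measureDI mu mE (mF _ Pi)) addeC leeD//.
  apply: ih => //; first by apply: measurableD => //; exact: mF.
  move=> j x js Pj Fx; split; first by apply: FE Fx; rewrite // in_cons js orbT.
  by move=> Fix; move: is_; rewrite (Fdisj _ _ _ Pi Pj Fix Fx) js.
rewrite le_eqVlt; apply/orP; left; apply/eqP; congr (mu _).
rewrite setIidr// => x Fx; apply: FE Fx => //; exact: mem_head.
Qed.

End finite_unions.

Section independence.
Variable R : realType.
Local Notation mu := (@lebesgue_measure R).
Local Notation I := (unit_interval R).

Lemma measurable_unit_interval : measurable I.
Proof. exact: measurable_itv. Qed.

Lemma lebesgue_unit_interval : mu I = 1%E.
Proof. by rewrite /unit_interval lebesgue_measure_itv/= lte_fin ltr01 sube0. Qed.

Lemma independent_rvs_comp (f : nat -> R -> R) (phi : R -> R) :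
  measurable_fun setT phi -> independent_rvs f ->
  independent_rvs (fun k => phi \o f k).
Proof.
move=> mphi indf J A mA.
have := indf J (fun k => phi @^-1` A k); apply => k.
by rewrite -[X in measurable X]setTI; apply: mphi.
Qed.

Lemma independent_prod (f : nat -> R -> R) (A : nat -> set R) n :
  independent_rvs f -> (forall k, measurable (A k)) ->
  mu (I `&` [set x | forall k, (k < n)%N -> A k (f k x)]) =
  (\prod_(k < n) mu (I `&` f k @^-1` A k))%E.
Proof.
move=> indf mA; have := indf [fset k in iota 0 n]%fset A mA.
have -> : [set` [fset k in iota 0 n]%fset] = `I_n.
  by apply/seteqP; split => k /=; rewrite !inE mem_iota/= add0n.
have -> : \bigcap_(k in `I_n) (f k @^-1` A k) =
    [set x | forall k, (k < n)%N -> A k (f k x)].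
  by apply/seteqP; split => x.
move=> ->; rewrite -(big_mkord xpredT
  (fun k => mu (I `&` f k @^-1` A k))) /index_iota subn0.
apply: perm_big; apply: uniq_perm; rewrite ?iota_uniq ?fset_uniq//.
by move=> k; rewrite !inE.
Qed.

Definition cell_mass (f : R -> R) delta L j : R :=
  fine (mu (I `&` f @^-1` (level delta L @^-1` [set j]))).

Lemma measure_unitI_fin (A : set R) : measurable (I `&` A) ->
  mu (I `&` A) \is a fin_num.
Proof.
move=> mA; rewrite ge0_fin_numE//.
apply: (@le_lt_trans _ _ (mu I)); last by rewrite lebesgue_unit_interval ltry.
by apply: le_measure; rewrite ?inE//; exact: measurable_unit_interval.
Qed.

Lemma cell_massE f delta L j : measurable_fun I f -> 0 <= delta ->
  mu (I `&` f @^-1` (level delta L @^-1` [set j]))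
    = (cell_mass f delta L j)%:E.
Proof.
move=> mf d0; rewrite fineK// measure_unitI_fin//.
by apply: mf; [exact: measurable_unit_interval|exact: measurable_level].
Qed.

Lemma cell_mass_ge0 f delta L j : 0 <= cell_mass f delta L j.
Proof. by apply: fine_ge0. Qed.

Lemma cell_mass_le1 f delta L j : measurable_fun I f -> 0 <= delta ->
  cell_mass f delta L j <= 1.
Proof.
move=> mf d0; rewrite -lee_fin -cell_massE// -lebesgue_unit_interval.
apply: le_measure; rewrite ?inE//; last exact: measurable_unit_interval.
by apply: mf; [exact: measurable_unit_interval|exact: measurable_level].
Qed.

(** Rectangles are indexed by natural numbers; beyond [n] the level [0] is a
    default that no condition [k < n] sees. *)
Definition ffun_nat n L (v : {ffun 'I_n -> 'I_L.+1}) (k : nat) : nat :=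
  if insub k is Some i then v i else 0%N.

Lemma ffun_natE n L (v : {ffun 'I_n -> 'I_L.+1}) (k : 'I_n) :
  ffun_nat v k = v k.
Proof. by rewrite /ffun_nat valK. Qed.

(** Once the variables take finitely many levels, an event on their sum is
    covered by finitely many rectangles, whose measures are products. This is
    what discretization is for: no convolution of measures is needed. *)
Lemma independent_level_tail (f : nat -> R -> R) delta L n (T : pred nat)
    (E : set R) :
  0 <= delta -> (forall k, measurable_fun I (f k)) -> independent_rvs f ->
  measurable E ->
  E `<=` I `&` [set x | T (\sum_(k < n) level delta L (f k x))%N] ->
  (mu E <=
   (\sum_(v : {ffun 'I_n -> 'I_L.+1} | T (\sum_(k < n) v k)%N)
      \prod_(k < n) cell_mass (f k) delta L (v k))%:E)%E.
Proof.
move=> d0 mf indf mE ET.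
pose F (v : {ffun 'I_n -> 'I_L.+1}) := I `&`
  [set x | forall k, (k < n)%N -> level delta L (f k x) = ffun_nat v k].
have mF v : measurable (F v).
  rewrite (_ : F v = I `&` \bigcap_(k in `I_n)
      (I `&` f k @^-1` (level delta L @^-1` [set ffun_nat v k]))); last first.
    apply/seteqP; split => x [Ix xv]; split=> // k kn; first by split => //; exact: xv.
    by have [] := xv k kn.
  apply: measurableI; first exact: measurable_unit_interval.
  apply: bigcap_measurableType.
  move=> k _; apply: mf; first exact: measurable_unit_interval.
  exact: measurable_level.
have -> : (\sum_(v : {ffun 'I_n -> 'I_L.+1} | T (\sum_(k < n) v k)%N)
      \prod_(k < n) cell_mass (f k) delta L (v k))%:E =
    (\sum_(v : {ffun 'I_n -> 'I_L.+1} | T (\sum_(k < n) v k)%N) mu (F v))%E.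
  rewrite -sumEFin; apply: eq_bigr => v _.
  rewrite /F (@independent_prod _ (fun k => level delta L @^-1` [set ffun_nat v k]))//.
    by rewrite -prodEFin; apply: eq_bigr => k _; rewrite cell_massE// ffun_natE.
  by move=> k; exact: measurable_level.
apply: le_trans; last by apply: measure_le_sum => v _; exact: mF.
have mU : measurable (\big[setU/set0]_(v : {ffun 'I_n -> 'I_L.+1} |
    T (\sum_(k < n) v k)%N) F v).
  by apply: bigsetU_measurable => v _; exact: mF.
apply: le_measure; rewrite ?inE// => x /ET[Ix Tx].
rewrite -bigcup_seq_cond.
exists [ffun k : 'I_n => inord (level delta L (f k x))] => /=.
  rewrite mem_index_enum/=.
  rewrite (eq_bigr (fun k : 'I_n => level delta L (f k x)))//.
  by move=> k _; rewrite ffunE inordK// ltnS level_le.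
split=> // k kn; rewrite -[k]/(nat_of_ord (Ordinal kn)) ffun_natE ffunE.
by rewrite inordK// ltnS level_le.
Qed.
End independence.

(** * The Kruglov operator on rectangles *)

Section kruglov.
Variables (R : realType) (P : probability (sequence_space R) R).
Variable B : nat -> set R.
Hypotheses (HP : is_product_measure P) (HB : kruglov_sets B).
Local Notation mu := (@lebesgue_measure R).
Local Notation I := (unit_interval R).
Local Notation cube := (cube R : set (sequence_space R)).

Lemma measurable_coordinate (A : set R) k : measurable A ->
  measurable ([set w | A (w k)] : set (sequence_space R)).
Proof. by move=> mA; apply: sub_gen_smallest; exists k; exists A. Qed.

Lemma measurable_fun_coordinate k :
  measurable_fun setT ((fun w => w k) : sequence_space R -> R).
Proof.
move=> _ A mA; rewrite setTI.
exact: (measurable_coordinate k mA).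
Qed.

Lemma measurable_cube : measurable cube.
Proof.
rewrite (_ : cube = \bigcap_k [set w | I (w k)]).
  apply: bigcap_measurableType => k _; apply: measurable_coordinate.
  exact: measurable_unit_interval.
by apply/seteqP; split => w Iw k; [move=> _; exact: Iw|exact: Iw].
Qed.

Lemma cube_negligible : P (~` cube) = 0%E.
Proof.
apply/eqP; rewrite eq_le measure_ge0 andbT.
rewrite (_ : ~` cube = \bigcup_k [set w | (~` I) (w k)]); last first.
  apply/seteqP; split => w /=.
    by move/existsNP => [k nI]; exists k.
  by move=> [k _ nI] Iw; exact: (nI (Iw k)).
have mk k : measurable ([set w | (~` I) (w k)] : set (sequence_space R)).
  apply: measurable_coordinate; apply: measurableC.
  exact: measurable_unit_interval.
apply: le_trans (generalized_Boole_inequality _ _ _) _ => //.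
  exact: bigcup_measurable.
rewrite eseries0// => k _ _.
pose A j := if j == k then ~` I else setT.
have mA j : measurable (A j).
  rewrite /A; case: ifP => _ //.
  by apply: measurableC; exact: measurable_unit_interval.
have := HP k.+1 mA; rewrite big_ord_recr/= /A eqxx setICr measure0 mule0 => PA.
apply/eqP; rewrite eq_le measure_ge0 andbT -PA.
apply: le_measure; rewrite ?inE; first exact: mk.
  rewrite (_ : [set w | _] = \bigcap_(j in `I_k.+1) [set w | A j (w j)]).
    by apply: bigcap_measurableType => j _; exact: measurable_coordinate.
  by apply/seteqP; split => w.
by move=> w /= nI j jk; case: eqP => [->|].
Qed.

(** The complement of the cube is a countable union of null sets. *)
Lemma measure_cubeI (E : set (sequence_space R)) : measurable E ->
  P (cube `&` E) = P E.
Proof.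
move=> mE.
have PE : P E = (P (E `\` cube) + P (E `&` cube))%E :=
  measureDI P mE measurable_cube.
suff E0 : P (E `\` cube) = 0%E by rewrite PE E0 add0e setIC.
apply/eqP; rewrite eq_le measure_ge0 andbT -cube_negligible.
apply: le_measure; rewrite ?inE.
- by apply: measurableD => //; exact: measurable_cube.
- by apply: measurableC; exact: measurable_cube.
- by move=> w [].
Qed.

(** [B m] prescribes [m] jumps, whose sizes are drawn by the coordinates
    [1, ..., m]: this is the law of a compound Poisson variable, one number of
    jumps at a time. *)
Lemma kruglov_rectangle m (A : nat -> set R) : (0 < m)%N ->
  (forall k, measurable (A k)) ->
  P [set w | B m (w 0%N) /\ forall k, (k < m)%N -> A k (w k.+1)] =
  ((expR 1 * m`!%:R)^-1%:E * \prod_(k < m) mu (I `&` A k))%E.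
Proof.
move=> m0 mA; have [/(_ _ m0)[mB BI] _ lB] := HB.
pose A' k := if k is k'.+1 then A k' else B m.
have := HP m.+1 (_ : forall k, measurable (A' k)).
rewrite big_ord_recl/= (setIidr BI) lB// => <-; last by case.
congr (P _); apply/seteqP; split => w /=.
  by move=> [Bw Aw] [//|k]; exact: Aw.
by move=> Aw; split => [|k km]; [exact: (Aw 0%N)|exact: (Aw k.+1)].
Qed.

Lemma measurable_rectangle m (A : nat -> set R) : (0 < m)%N ->
  (forall k, measurable (A k)) ->
  measurable ([set w | B m (w 0%N) /\ forall k, (k < m)%N -> A k (w k.+1)]
    : set (sequence_space R)).
Proof.
move=> m0 mA; have [/(_ _ m0)[mB BI] _ lB] := HB.
rewrite (_ : mkset _ = [set w | B m (w 0%N)] `&`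
    \bigcap_(k in `I_m) [set w | A k (w k.+1)]); last by apply/seteqP; split.
apply: measurableI; first exact: measurable_coordinate.
by apply: bigcap_measurableType => k _; exact: measurable_coordinate.
Qed.

Lemma kruglovE f w m : (0 < m)%N -> B m (w 0%N) ->
  kruglov B f w = \sum_(1 <= k < m.+1) f (w k).
Proof.
move=> m0 Bm; have [_ tB _] := HB.
have B0 n : (0 < n)%N -> n != m -> \1_(B n) (w 0%N) = 0 :> R.
  move=> n0 nm; rewrite indicE memNset// => Bn; move: nm.
  by rewrite (tB n m)//; [rewrite eqxx|exists (w 0%N)].
rewrite /kruglov; apply: lim_near_cst => //; near=> N.
rewrite (bigD1_seq m)/= ?iota_uniq//; last first.
  by rewrite mem_index_iota m0/=; near: N; exact: nbhs_infty_gt.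
rewrite [X in _ + X]big_nat_cond [X in _ + X]big1 ?addr0.
  apply: eq_bigr => k _.
  by rewrite indicE mem_set// mulr1.
move=> n /andP[/andP[n0 _] nm]; apply: big1 => k _.
by rewrite B0// mulr0.
Unshelve. all: by end_near. Qed.

Lemma kruglov0 f w : (forall m, (0 < m)%N -> ~ B m (w 0%N)) ->
  kruglov B f w = 0.
Proof.
move=> nB; rewrite /kruglov; apply: lim_near_cst => //; near=> N.
rewrite big_nat_cond big1// => n /andP[/andP[n0 _] _].
apply: big1 => k _; rewrite indicE memNset ?mulr0//.
exact: nB.
Unshelve. all: by end_near. Qed.

Definition jump_event (f : R -> R) (s : R) m : set (sequence_space R) :=
  cube `&` [set w | B m (w 0%N) /\ s < `|\sum_(1 <= k < m.+1) f (w k)|].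

Lemma measurable_jump_event f s m : (0 < m)%N -> measurable_fun I f ->
  measurable (jump_event f s m).
Proof.
move=> m0 mf; have [/(_ _ m0)[mB BI] _ lB] := HB.
have mfI : measurable_fun setT (f \_ I).
  apply/(measurable_restrictT _ _).1 => //; exact: measurable_unit_interval.
rewrite (_ : jump_event _ _ _ = cube `&` ([set w | B m (w 0%N)] `&`
   [set w | (s < `|\sum_(1 <= k < m.+1) (f \_ I) (w k)|)%R])).
  apply: measurableI; first exact: measurable_cube.
  apply: measurableI; first exact: measurable_coordinate.
  rewrite (_ : [set w | _] = (fun w : sequence_space R =>
     `|\sum_(1 <= k < m.+1) (f \_ I) (w k)|) @^-1` [set` `]s, +oo[]); last first.
    by apply/seteqP; split => w /=; rewrite in_itv/= andbT.
  rewrite -[X in measurable X]setTI.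
  suff : measurable_fun setT (fun w : sequence_space R =>
     `|\sum_(1 <= k < m.+1) (f \_ I) (w k)|) by apply => //; exact: measurable_itv.
  apply: measurableT_comp => //; apply: measurable_sum => k.
  by apply: measurableT_comp => //; exact: measurable_fun_coordinate.
apply/seteqP; split => w /= [cw [Bw]].
  move=> sw; do 2 split => //; move: sw; congr (_ < `| _ |).
  by apply: eq_bigr => k _; rewrite patchE mem_set//; exact: cw.
move=> sw; do 2 split => //; move: sw; congr (_ < `| _ |).
by apply: eq_bigr => k _; rewrite patchE mem_set//; exact: cw.
Qed.

(** Off the sets [B m] the image vanishes, so that only nonnegative [s] give a
    union over the numbers of jumps. *)
Lemma kruglov_eventE f s : 0 <= s ->
  cube `&` [set w | s < `|kruglov B f w|] =
  \bigcup_(m in [set m | (0 < m)%N]) jump_event f s m.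
Proof.
move=> s0; apply/seteqP; split => w /=.
  move=> [cw sK]; have [[m m0 Bm]|nB] := pselect (exists2 m, (0 < m)%N & B m (w 0%N)).
    by exists m => //; split=> //=; split=> //; rewrite -(kruglovE _ m0 Bm).
  move: sK; rewrite kruglov0 ?normr0; first by rewrite ltNge s0.
  by move=> m m0 Bm; apply: nB; exists m.
move=> [m m0 [cw [Bm sw]]]; split => //=.
by rewrite (kruglovE _ m0 Bm).
Qed.

Lemma measurable_kruglov_event f s : 0 <= s -> measurable_fun I f ->
  measurable (cube `&` [set w | s < `|kruglov B f w|]).
Proof.
move=> s0 mf; rewrite kruglov_eventE//; apply: bigcup_measurable => m m0.
exact: measurable_jump_event.
Qed.

Lemma jump_event_sum_le f s N : 0 <= s -> measurable_fun I f ->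
  (\sum_(m < N.+1 | (0 < m)%N) P (jump_event f s m)
    <= distribution_function P cube (kruglov B f) s)%E.
Proof.
move=> s0 mf; apply: sum_measure_le.
- exact: index_enum_uniq.
- exact: measurable_kruglov_event.
- by move=> m m0; exact: measurable_jump_event.
- by move=> m m0; rewrite kruglov_eventE// => w jw; exists m.
move=> i j w i0 j0 [_ [Bi _]] [_ [Bj _]]; apply/val_inj.
by have [_ tB _] := HB; apply: tB => //; exists (w 0%N).
Qed.

Lemma jump_event_le f s m : (0 < m)%N -> 0 <= s -> measurable_fun I f ->
  (P (jump_event f s m) <= distribution_function P cube (kruglov B f) s)%E.
Proof.
move=> m0 s0 mf; apply: le_measure; rewrite ?inE.
- exact: measurable_jump_event.
- exact: measurable_kruglov_event.
by rewrite kruglov_eventE// => w jw; exists m.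
Qed.

Lemma rectangle_le_jump_event (f : R -> R) s m (A : nat -> set R) : (0 < m)%N ->
  measurable_fun I f -> (forall k, measurable (A k)) ->
  (forall w : nat -> R, cube w -> (forall k, (k < m)%N -> A k (w k.+1)) ->
     s < `|\sum_(1 <= k < m.+1) f (w k)|) ->
  ((expR 1 * m`!%:R)^-1%:E * \prod_(k < m) mu (I `&` A k)
     <= P (jump_event f s m))%E.
Proof.
move=> m0 mf mA sA; rewrite -kruglov_rectangle//.
rewrite -measure_cubeI; last exact: measurable_rectangle.
apply: le_measure; rewrite ?inE.
- by apply: measurableI; [exact: measurable_cube|exact: measurable_rectangle].
- exact: measurable_jump_event.
by move=> w [cw [Bw Aw]]; do 2 split => //; exact: sA.
Qed.

(** On the rectangle with prescribed levels [v] the image is at least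
    [delta * \sum v], and rectangles with different [v] are disjoint. *)
Lemma jump_event_level (f : R -> R) delta L M m : (0 < m)%N -> 0 < delta ->
  measurable_fun I f -> (forall x, I x -> 0 <= f x) ->
  ((expR 1 * m`!%:R)^-1%:E *
    (\sum_(v : {ffun 'I_m -> 'I_L.+1} | (M < \sum_(k < m) v k)%N)
      \prod_(k < m) cell_mass f delta L (v k))%:E
    <= P (jump_event f (M%:R * delta) m))%E.
Proof.
move=> m0 d0 mf f0; have d0' := ltW d0.
pose A j := I `&` f @^-1` (level delta L @^-1` [set j]).
have mA j : measurable (A j).
  by apply: mf; [exact: measurable_unit_interval|exact: measurable_level].
pose F (v : {ffun 'I_m -> 'I_L.+1}) := cube `&`
  [set w | B m (w 0%N) /\ forall k, (k < m)%N -> A (ffun_nat v k) (w k.+1)].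
have -> : ((expR 1 * m`!%:R)^-1%:E *
    (\sum_(v : {ffun 'I_m -> 'I_L.+1} | (M < \sum_(k < m) v k)%N)
      \prod_(k < m) cell_mass f delta L (v k))%:E)%E =
    (\sum_(v : {ffun 'I_m -> 'I_L.+1} | (M < \sum_(k < m) v k)%N) P (F v))%E.
  rewrite -EFinM mulr_sumr -sumEFin; apply: eq_bigr => v _.
  rewrite /F measure_cubeI; last first.
    by apply: (@measurable_rectangle m (fun k => A (ffun_nat v k))) => // k; exact: mA.
  rewrite (kruglov_rectangle m0 (fun k => mA (ffun_nat v k))) EFinM -prodEFin.
  congr (_ * _)%E; apply: eq_bigr => k _.
  by rewrite /A setIA setIid cell_massE// ffun_natE.
apply: sum_measure_le.
- exact: index_enum_uniq.
- exact: measurable_jump_event.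
- move=> v _; apply: measurableI; first exact: measurable_cube.
  by apply: (@measurable_rectangle m (fun k => A (ffun_nat v k))) => // k; exact: mA.
- move=> v Mv w [cw [Bw Aw]]; do 2 split => //.
  rewrite big_add1/= big_mkord.
  apply: (@lt_le_trans _ _ (\sum_(k < m) (v k)%:R * delta)).
    by rewrite -mulr_suml ltr_pM2r// -natr_sum ltr_nat.
  apply: le_trans (ler_norm _); apply: ler_sum => k _.
  have [Iw] := Aw k (ltn_ord k); rewrite ffun_natE/= => <-.
  by apply: level_mul_le => //; exact: f0.
move=> u v w _ _ [_ [_ uw]] [_ [_ vw]]; apply/ffunP => k; apply/val_inj => /=.
have [_ /=] := uw k (ltn_ord k); have [_ /=] := vw k (ltn_ord k).
by rewrite !ffun_natE => -> ->.
Qed.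

End kruglov.

(** * Sums of independent variables against Kruglov images *)

Section kruglov_domination.
Variables (R : realType) (P : probability (sequence_space R) R).
Variable B : nat -> set R.
Hypotheses (HP : is_product_measure P) (HB : kruglov_sets B).
Local Notation mu := (@lebesgue_measure R).
Local Notation I := (unit_interval R).
Local Notation cube := (cube R : set (sequence_space R)).

(** From [exp (- 1 / 2) >= 1 / 2]. *)
Lemma expR1_le4 : expR 1 <= 4 :> R.
Proof.
have h : expR (2^-1) <= 2 :> R.
  rewrite -[expR _]invrK -expRN -[leRHS]invrK lef_pV2 ?posrE ?expR_gt0 ?invr_gt0//.
  by apply: le_trans (expR_ge1Dx _); lra.
have -> : expR 1 = expR 2^-1 * expR 2^-1 :> R by rewrite -expRD; congr expR; lra.
apply: (@le_trans _ _ (2 * 2)); last lra.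
by rewrite ler_pM// expR_ge0.
Qed.

Lemma measurable_gt (D : set R) (f : R -> R) (s : R) : measurable D ->
  measurable_fun D f -> measurable (D `&` [set x | s < `|f x|]).
Proof.
move=> mD mf; rewrite (_ : [set x | _] = (fun x => `|f x|) @^-1` [set` `]s, +oo[]).
  have : measurable_fun D (fun x => `|f x|) by exact: measurableT_comp.
  by apply => //; exact: measurable_itv.
by apply/seteqP; split => x /=; rewrite in_itv/= andbT.
Qed.

(** With the step [delta = s / (2 n)] rounding down loses at most
    [n * delta = s / 2] in total, and the cap [2 n] is harmless because a capped
    summand makes the sum of the levels exceed [n] alone. The law of the sum of
    the levels is then compared, through [poisson_domination], with the laws of
    the sums of [m] independent copies of [G]; such a sum is the value of [K G]
    with probability [1 / (e * m!)], and the factor [4] absorbs [e]. *)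
Lemma sum_tail_le_kruglov (g : nat -> R -> R) (G : R -> R) n :
  (forall k, measurable_fun I (g k)) -> independent_rvs g ->
  (forall k x, I x -> 0 <= g k x) ->
  measurable_fun I G -> (forall x, I x -> 0 <= G x) ->
  (forall a b, 0 < a ->
    (\sum_(k < n) mu (I `&` g k @^-1` cell a b) <= mu (I `&` G @^-1` cell a b))%E) ->
  forall s, 0 < s ->
    (distribution_function mu I (fun x => \sum_(k < n) g k x)%R s <=
     4%:E * distribution_function P cube (kruglov B G) (s / 2)%R)%E.
Proof.
move=> mg indg g0 mG G0 gG s s0.
case: n gG => [|n'] gG.
  rewrite /distribution_function (_ : _ `&` _ = set0) ?measure0 ?mule_ge0//.
  apply/seteqP; split=> x //= [_]; rewrite big_ord0 normr0.
  by rewrite ltNge ltW.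
set n := n'.+1 in gG *.
pose delta := s / (2 * n)%:R; pose L := (2 * n)%N.
have d0 : 0 < delta by rewrite divr_gt0.
have ndelta : n%:R * delta = s / 2.
  by rewrite /delta natrM; field; rewrite pnatr_eq0.
have lev x : I x -> s < \sum_(k < n) g k x ->
    (n < \sum_(k < n) level delta L (g k x))%N.
  move=> Ix; apply: contraPltn => lev; apply/negP; rewrite -leNgt.
  apply: (@le_trans _ _ (\sum_(k < n) (level delta L (g k x)).+1%:R * delta)).
    apply: ler_sum => k _; apply: le_level_mul; first exact: ltW.
    have : (level delta L (g k x) <= n)%N.
      by apply: leq_trans lev; rewrite (bigD1 k)//= leq_addr.
    by rewrite /L; lia.
  rewrite -mulr_suml.
  have -> : s = (n + n)%:R * delta by rewrite natrD mulrDl ndelta; field.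
  rewrite ler_wpM2r ?(ltW d0)// -natr_sum ler_nat.
  under eq_bigr do rewrite -addn1.
  by rewrite big_split/= sum1_card card_ord leq_add2r.
apply: (@le_trans _ _ (\sum_(v : {ffun 'I_n -> 'I_L.+1} |
    (n < \sum_(k < n) v k)%N) \prod_(k < n) cell_mass (g k) delta L (v k))%:E).
  apply: (@independent_level_tail _ _ _ _ _ (fun i => (n < i)%N)) => //.
  - exact: ltW.
  - apply: measurable_gt; first exact: measurable_unit_interval.
    by apply: measurable_sum => k; exact: mg.
  - move=> x [Ix /= sx]; split => //=; apply: lev => //.
    by rewrite ger0_norm// in sx; apply: sumr_ge0 => k _; exact: g0.
apply: (@le_trans _ _ (\sum_(m < n.+1) (m`!%:R)^-1 *
    \sum_(v : {ffun 'I_m -> 'I_L.+1} | (n < \sum_(k < m) v k)%N)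
      \prod_(k < m) cell_mass G delta L (v k))%:E).
  rewrite lee_fin.
  apply: (@poisson_domination _ L n n (fun k => cell_mass (g k) delta L)
    (cell_mass G delta L)).
  - by move=> k j; exact: cell_mass_ge0.
  - by move=> k; apply: cell_mass_le1 => //; exact: ltW.
  - by move=> j; exact: cell_mass_ge0.
  - move=> j /[dup] jL /andP[j0 _]; rewrite -lee_fin -sumEFin.
    rewrite -cell_massE//; last exact: ltW.
    under eq_bigr do rewrite -cell_massE ?ltW//.
    rewrite level_cell//; last exact: ltW.
    by apply: gG; rewrite mulr_gt0// ltr0n.
rewrite big_ord_recl/= [X in _ * X + _]big_pred0; last first.
  by move=> v; rewrite big_ord0 ltn0.
rewrite mulr0 add0r.
have e4 : (0 <= 4%:E :> \bar R)%E by [].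
have s20 : 0 <= s / 2 by rewrite divr_ge0// ltW.
have := @jump_event_sum_le _ P _ HB G (s / 2) n s20 mG.
rewrite big_mkcond/= big_ord_recl/= add0e => jumps.
apply: (@le_trans _ _ (4%:E * \sum_(i < n) P (jump_event B G (s / 2) i.+1))%E).
  rewrite -sumEFin ge0_sume_distrr//; apply: lee_sum => i _.
  have := @jump_event_level _ P _ HP HB G delta L n i.+1 isT d0 mG G0.
  rewrite ndelta => /(lee_wpmul2l e4); apply: le_trans.
  rewrite -!EFinM lee_fin invfM !mulrA; apply: ler_wpM2r.
    by apply: sumr_ge0 => v _; apply: prodr_ge0 => k _; exact: cell_mass_ge0.
  rewrite -[leLHS]mul1r; apply: ler_wpM2r; first by rewrite invr_ge0.
  by rewrite ler_pdivlMr ?expR_gt0// mul1r expR1_le4.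
exact: lee_wpmul2l.
Qed.

(** The means of [x ^ i] over [i < j] increase with [j]. *)
Lemma exprB1_le (x : R) (j n : nat) : 1 <= x -> (j <= n)%N ->
  n%:R * (x ^+ j - 1) <= j%:R * (x ^+ n - 1).
Proof.
move=> x1; elim: n => [|n ih]; first by rewrite leqn0 => /eqP ->.
rewrite leq_eqVlt => /orP[/eqP -> //|]; rewrite ltnS => jn.
have -> : n.+1%:R * (x ^+ j - 1) = n%:R * (x ^+ j - 1) + (x ^+ j - 1).
  by rewrite -natr1 mulrDl mul1r.
have -> : j%:R * (x ^+ n.+1 - 1) =
    j%:R * (x ^+ n - 1) + (x - 1) * (j%:R * x ^+ n) by rewrite exprS; ring.
apply: lerD; first exact: ih.
rewrite subrX1 ler_wpM2l ?subr_ge0//.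
rewrite mulr_natl -[j in leRHS]card_ord -sumr_const.
apply: ler_sum => i _; apply: ler_weXn2l => //.
exact: leq_trans (ltnW (ltn_ord i)) jn.
Qed.

Lemma fact_le_expn m : (m`! <= m ^ m)%N.
Proof.
rewrite fact_prod big_add1/= big_mkord.
rewrite -[X in (_ <= _ ^ X)%N]card_ord -prod_nat_const.
by apply: leq_prod => i _.
Qed.

Section level_mass.
Variables (f : R -> R) (delta : R) (L : nat).
Hypotheses (mf : measurable_fun I f) (delta0 : 0 <= delta).

Lemma sum_cell_mass_le1 : \sum_(j < L.+1) cell_mass f delta L j <= 1.
Proof.
rewrite -lee_fin -sumEFin -lebesgue_unit_interval.
under eq_bigr do rewrite -cell_massE//.
apply: sum_measure_le.
- exact: index_enum_uniq.
- exact: measurable_unit_interval.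
- move=> j _; apply: mf; first exact: measurable_unit_interval.
  exact: measurable_level.
- by move=> j _ x [].
- by move=> i j x _ _ [_ /= li] [_ /= lj]; apply/val_inj; rewrite /= -li -lj.
Qed.

(** The mean of an integer variable is the sum of its tails. *)
Lemma mean_cell_mass_le : ((\sum_(j < L.+1) cell_mass f delta L j * j%:R)%:E <=
  \sum_(i < L) mu (I `&` [set x | (i.+1%:R * delta < f x)%R]))%E.
Proof.
have -> : \sum_(j < L.+1) cell_mass f delta L j * j%:R =
    \sum_(i < L) \sum_(j < L.+1 | (i < j)%N) cell_mass f delta L j.
  rewrite (exchange_big_dep xpredT)//=; apply: eq_bigr => j _.
  rewrite sumr_const mulr_natr; congr (_ *+ _).
  rewrite -[LHS]card_ord -!sum1_card.
  by rewrite (big_ord_widen L (fun=> 1%N)) ?leq_ord//; exact: eq_bigl.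
rewrite -sumEFin; apply: lee_sum => i _; rewrite -sumEFin.
under eq_bigr do rewrite -cell_massE//.
apply: sum_measure_le.
- exact: index_enum_uniq.
- rewrite (_ : [set x | _] = f @^-1` [set` `](i.+1%:R * delta), +oo[]).
    by apply: mf; [exact: measurable_unit_interval|exact: measurable_itv].
  by apply/seteqP; split => x /=; rewrite in_itv/= andbT.
- move=> j _; apply: mf; first exact: measurable_unit_interval.
  exact: measurable_level.
- move=> j ij x [Ix /= fj]; split=> //=.
  have := ltn_level L (f x) i delta0.
  by rewrite fj ij => /esym/andP[].
- by move=> j k x _ _ [_ /= li] [_ /= lj]; apply/val_inj; rewrite /= -li -lj.
Qed.

End level_mass.


(** Chernoff's bound for the discretized variables [level zeta_k / n]: the base
    [x] is an [n]-th root of [m], so that [x ^ j <= 1 + j / n * (m - 1)]. *)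
Lemma level_tail_le_fact (zeta : nat -> R -> R) n m (E : set R) :
  (0 < n)%N -> (1 < m)%N ->
  (forall k, measurable_fun I (zeta k)) -> independent_rvs zeta ->
  (\sum_(k < n) \sum_(j < n) mu (I `&` [set x | (j.+1%:R * n%:R^-1 < zeta k x)%R])
    <= n%:R%:E)%E ->
  measurable E ->
  E `<=` I `&` [set x | (3 * m * n <= \sum_(k < n) level n%:R^-1 n (zeta k x))%N] ->
  (mu E <= (m`!%:R)^-1%:E)%E.
Proof.
move=> n0 m1 mz indz meanz mE Elev.
have d0 : 0 <= n%:R^-1 :> R by rewrite invr_ge0.
have m0 : (0 < m)%N by exact: ltnW.
have mR : 0 < m%:R :> R by rewrite ltr0n.
pose w k j := cell_mass (zeta k) n%:R^-1 n j.
apply: le_trans (@independent_level_tail _ _ _ n n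
  (fun i => 3 * m * n <= i)%N E d0 mz indz mE Elev) _.
rewrite lee_fin.
pose x : R := m%:R `^ n%:R^-1.
have x1 : 1 <= x.
  by rewrite -[leLHS](powRr0 m%:R); apply: ler_powR => //; rewrite ler1n.
have xn : x ^+ n = m%:R.
  rewrite -powR_mulrn ?powR_ge0// -powRrM mulVf ?powRr1 ?ltW//.
  by rewrite pnatr_eq0 -lt0n.
pose M := (3 * m * n)%N.
have xM : 0 < x ^+ M by rewrite exprn_gt0// (lt_le_trans ltr01).
apply: (@le_trans _ _ (x ^- M * \prod_(k < n) \sum_(j < n.+1) w k j * x ^+ j)).
  rewrite bigA_distr_bigA/= mulr_sumr big_mkcond/=; apply: ler_sum => v _.
  have w0 : 0 <= \prod_(k < n) w k (v k).
    by apply: prodr_ge0 => k _; exact: cell_mass_ge0.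
  rewrite big_split/= prodrXr mulrCA.
  case: ifP => [Mv|_]; last first.
    by rewrite mulr_ge0// mulr_ge0// ?invr_ge0 ?exprn_ge0// ?ltW// (lt_le_trans ltr01).
  rewrite ler_peMr// ler_pdivlMl// mulr1.
  exact: ler_weXn2l.
have wx (k : 'I_n) : \sum_(j < n.+1) w k j * x ^+ j <=
    expR (n%:R^-1 * (\sum_(j < n.+1) w k j * j%:R) * (m%:R - 1)).
  apply: le_trans (expR_ge1Dx _).
  apply: (@le_trans _ _ (\sum_(j < n.+1) (w k j +
      w k j * (n%:R^-1 * j%:R * (m%:R - 1))))).
    apply: ler_sum => j _; rewrite -[X in X + _]mulr1 -mulrDr.
    apply: ler_wpM2l; first exact: cell_mass_ge0.
    rewrite -lerBlDl -mulrA ler_pdivlMl ?ltr0n// -xn.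
    by apply: exprB1_le => //; rewrite -ltnS.
  rewrite big_split/= lerD//; first exact: sum_cell_mass_le1.
  rewrite mulr_sumr mulr_suml le_eqVlt; apply/orP; left; apply/eqP.
  by apply: eq_bigr => j _; ring.
apply: (@le_trans _ _ (x ^- M * expR (m%:R - 1))).
  apply: ler_wpM2l; first by rewrite invr_ge0 ltW.
  apply: (@le_trans _ _ (\prod_(k < n)
      expR (n%:R^-1 * (\sum_(j < n.+1) w k j * j%:R) * (m%:R - 1)))).
    apply: ler_prod => k _; rewrite wx andbT; apply: sumr_ge0 => j _.
    by rewrite mulr_ge0 ?cell_mass_ge0// exprn_ge0// (le_trans ler01).
  rewrite -expR_sum ler_expR -mulr_suml -mulr_sumr.
  rewrite -[leRHS]mul1r; apply: ler_wpM2r; first by rewrite subr_ge0 ler1n.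
  rewrite ler_pdivrMl ?ltr0n// mulr1 -lee_fin -sumEFin.
  apply: le_trans meanz; apply: lee_sum => k _.
  exact: mean_cell_mass_le.
(* [m ^ m >= m!] and [m ^ (2 * m) >= 4 ^ m >= exp (m - 1)]. *)
have -> : x ^+ M = m%:R ^+ m * m%:R ^+ (m + m).
  by rewrite /M mulnC exprM xn -exprD; congr (_ ^+ _); lia.
have mm : 0 < m%:R ^+ m :> R by rewrite exprn_gt0.
rewrite invfM -mulrA -[leRHS]mulr1; apply: ler_pM.
- by rewrite invr_ge0 ltW.
- by rewrite mulr_ge0 ?expR_ge0// invr_ge0 exprn_ge0// ltW.
- rewrite lef_pV2 ?posrE ?ltr0n ?fact_gt0//.
  by rewrite -natrX ler_nat fact_le_expn.
rewrite ler_pdivrMl ?exprn_gt0// mulr1.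
apply: (@le_trans _ _ (4 ^+ m)).
  apply: (@le_trans _ _ (expR 1 ^+ m)).
    by rewrite -expRM_natl mulr1 ler_expR lerBlDr lerDl.
  by rewrite lerXn2r ?nnegrE ?expR_ge0// expR1_le4.
rewrite addnn -mul2n exprM lerXn2r ?nnegrE ?exprn_ge0 ?(ltW mR)//.
by rewrite -natrX ler_nat (@leq_exp2r 2 m 2).
Qed.

(** The image of the constant [1] counts jumps, so that it is at least [m] with
    probability at least [1 / (e * m!)], and it suffices to bound the left-hand
    tail by [1 / m!], where [m] is the least integer above [s / 7]. There is
    nothing to do for [m = 1]. For [m >= 2] one has [s >= 7 * (m - 1)], and the
    rounding loses at most [1], so that the sum of the rounded variables is at
    least [7 * (m - 1) - 1 >= 3 * m]: Chernoff's bound applies. *)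
Lemma bounded_sum_tail_le_kruglov (zeta : nat -> R -> R) n :
  (forall k, measurable_fun I (zeta k)) -> independent_rvs zeta ->
  (forall k x, I x -> 0 <= zeta k x <= 1) ->
  (forall L, (0 < L)%N -> (\sum_(k < n) \sum_(j < L)
    mu (I `&` [set x | (j.+1%:R * L%:R^-1 < zeta k x)%R]) <= L%:R%:E)%E) ->
  forall s, 0 < s ->
    (distribution_function mu I (fun x => \sum_(k < n) zeta k x)%R s <=
     4%:E * distribution_function P cube (kruglov B (\1_`]0, 1[)%R) (s / 7)%R)%E.
Proof.
move=> mz indz z01 meanz s s0.
have s70 : 0 <= s / 7 by rewrite divr_ge0// ltW.
pose m := (Num.truncn (s / 7)).+1.
have /andP[tms smt] := truncn_itv s70.
have mone : measurable_fun I (\1_`]0, 1[ : R -> R).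
  by apply: measurable_indic; exact: measurable_itv.
have m0 : (0 < m)%N by [].
apply: (@le_trans _ _ (m`!%:R)^-1%:E); last first.
  have h := @jump_event_le _ P _ HB _ _ m m0 s70 mone.
  apply: (@le_trans _ _ (4%:E * P (jump_event B (\1_`]0, 1[)%R (s / 7)%R m))%E); last first.
    exact: lee_wpmul2l.
  apply: (@le_trans _ _ (4%:E * ((expR 1 * m`!%:R)^-1)%:E)%E).
    rewrite -EFinM lee_fin invfM mulrA -[leLHS]mul1r.
    apply: ler_wpM2r; first by rewrite invr_ge0.
    by rewrite ler_pdivlMr ?expR_gt0// mul1r expR1_le4.
  apply: lee_wpmul2l => //.
  have := @rectangle_le_jump_event _ P _ HP HB \1_`]0, 1[ (s / 7) m
    (fun=> `]0, 1[%classic) m0 mone.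
  under eq_bigr.
    move=> k _; rewrite setIidr; last by apply: subset_itv_oo_cc.
    rewrite lebesgue_measure_itv/= lte_fin ltr01 sube0.
    over.
  rewrite big1// mule1; apply; first by move=> k; exact: measurable_itv.
  move=> w cw Aw; rewrite big_add1/= big_mkord.
  rewrite (eq_bigr (fun=> 1)); last first.
    by move=> k _; rewrite indicE mem_set//; exact: Aw.
  by rewrite sumr_const card_ord ger0_norm.
have mD : measurable (I `&` [set x | s < `|\sum_(k < n) zeta k x|]).
  apply: measurable_gt; first exact: measurable_unit_interval.
  by apply: measurable_sum => k; exact: mz.
rewrite /distribution_function.
case: (ltnP 1 m) => [m1|]; last first.
  rewrite leq_eqVlt ltnNge m0 orbF => /eqP ->; rewrite (_ : 1`! = 1%N)// invr1.
  rewrite -lebesgue_unit_interval; apply: le_measure; rewrite ?inE//.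
  exact: measurable_unit_interval.
case: (posnP n) => [n0|n0].
  rewrite (_ : _ `&` _ = set0) ?measure0//.
  apply/seteqP; split=> x //= [_]; rewrite n0 big_ord0 normr0.
  by rewrite ltNge ltW.
apply: (@level_tail_le_fact zeta n m) => //; first exact: meanz.
move=> x [Ix /= sx]; split=> //=.
rewrite ger0_norm in sx; last by apply: sumr_ge0 => k _; have /andP[] := z01 k x Ix.
have d0 : 0 <= n%:R^-1 :> R by rewrite invr_ge0.
have nR : 0 < n%:R :> R by rewrite ltr0n.
have : \sum_(k < n) zeta k x <= \sum_(k < n) (level n%:R^-1 n (zeta k x)).+1%:R * n%:R^-1.
  apply: ler_sum => k _.
  have := level_le n%:R^-1 n (zeta k x); rewrite leq_eqVlt => /orP[/eqP ->|].
    have /andP[_ z1] := z01 k x Ix; apply: (le_trans z1).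
    by rewrite ler_pdivlMr// mul1r ler_nat.
  exact: le_level_mul.
rewrite -mulr_suml -natr_sum.
under eq_bigr do rewrite -addn1.
rewrite big_split/= sum1_card card_ord natrD ler_pdivlMr// => sl.
rewrite -(ler_nat R) !natrM.
have : s * n%:R < (\sum_(k < n) level n%:R^-1 n (zeta k x))%N%:R + n%:R.
  by apply: lt_le_trans sl; rewrite ltr_pM2r.
have t1 : 1 <= (Num.truncn (s / 7))%:R :> R by rewrite ler1n; move: m1; rewrite /m ltnS.
move: tms; rewrite /m -(natr1 (Num.truncn (s / 7))) ler_pdivlMr// => t7 sS.
have t1n := ler_wpM2r (ltW nR) t1.
have t7n := ler_wpM2r (ltW nR) t7.
lra.
Qed.

End kruglov_domination.

(** * Rearrangements *)

Section rearrangement.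
Context d (T : measurableType d) (R : realType) (mu : {measure set T -> \bar R}).
Variables (D : set T) (h : T -> R).
Hypothesis mh : forall s, 0 <= s -> measurable (D `&` [set x | s < `|h x|]).

Lemma distribution_function_antitone s s' : 0 <= s -> s <= s' ->
  (distribution_function mu D h s' <= distribution_function mu D h s)%E.
Proof.
move=> s0 ss'; apply: le_measure; rewrite ?inE; [|exact: mh|].
  by apply: mh; exact: le_trans ss'.
by move=> x [Dx /= hx]; split=> //=; exact: le_lt_trans hx.
Qed.

(** Continuity from below along [s + 1 / (n + 1)]. *)
Lemma distribution_function_right_cont s (t : \bar R) : 0 <= s ->
  (forall s', s < s' -> (distribution_function mu D h s' <= t)%E) ->
  (distribution_function mu D h s <= t)%E.
Proof.
move=> s0 ht.
pose F n := D `&` [set x | s + n.+1%:R^-1 < `|h x|].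
have sn n : s < s + n.+1%:R^-1 by rewrite ltrDl invr_gt0.
have mF n : measurable (F n) by apply: mh; exact: (le_trans s0 (ltW (sn n))).
have FU : \bigcup_n F n = D `&` [set x | s < `|h x|].
  apply/seteqP; split => x /=.
    by move=> [n _ [Dx /= hx]]; split => //=; exact: lt_trans hx.
  move=> [Dx sx]; have hs : 0 < `|h x| - s by rewrite subr_gt0.
  exists (Num.truncn (`|h x| - s)^-1) => //; split=> //=.
  rewrite -ltrBrDl -[ltRHS]invrK ltf_pV2 ?posrE ?invr_gt0//.
  have hs' : 0 <= (`|h x| - s)^-1 by rewrite invr_ge0 ltW.
  by have /andP[] := truncn_itv hs'.
have cF : (mu \o F) n @[n --> \oo] --> mu (\bigcup_n F n).
  apply: nondecreasing_cvg_mu => //.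
    by apply: bigcupT_measurable.
  move=> n m nm; apply/subsetPset => x [Dx /= hx]; split=> //=.
  apply: le_lt_trans hx; rewrite lerD2l lef_pV2 ?posrE//.
  by rewrite ler_nat ltnS.
rewrite /distribution_function -FU -(cvg_lim _ cF)//.
apply: lime_le; first by apply/cvg_ex; exists (mu (\bigcup_n F n)).
by apply: nearW => n; exact: ht.
Qed.

Lemma rearrangement_ge0 t : (0 <= rearrangement mu D h t)%E.
Proof. by apply: le_ereal_inf_tmp => _ [s [s0 _] <-]; rewrite lee_fin. Qed.

Lemma rearrangement_antitone t t' : t <= t' ->
  (rearrangement mu D h t' <= rearrangement mu D h t)%E.
Proof.
move=> tt'; apply: ereal_inf_le_tmp => _ [s [s0 hs] <-]; exists s => //.
by split=> //; apply: (le_trans hs); rewrite lee_fin.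
Qed.

(** The rearrangement is a generalized inverse of the distribution function.
    Right continuity makes the infimum that defines it a minimum, which gives
    the equivalence for strict inequalities. *)
Lemma lt_rearrangement s t : 0 <= s ->
  (s%:E < rearrangement mu D h t)%E = (t%:E < distribution_function mu D h s)%E.
Proof.
move=> s0; rewrite !ltNge; congr (~~ _); apply/idP/idP => hs; last first.
  by apply: ge_ereal_inf; exists s%:E => //; exists s.
apply: distribution_function_right_cont => // s' ss'.
have : (rearrangement mu D h t < s'%:E)%E by apply: le_lt_trans hs _; rewrite lte_fin.
move=> /ereal_inf_lt[_ [s'' [s0'' hs''] <-]]; rewrite lte_fin => s''s'.
by apply: le_trans hs''; apply: distribution_function_antitone => //; exact: ltW.
Qed.

End rearrangement.

(** Only positive [s] are compared: a level [s] in the set that defines the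
    right-hand infimum gives the levels [s + e] on the left. *)
Lemma le_rearrangement d1 (T1 : measurableType d1) d2 (T2 : measurableType d2)
    (R : realType) (mu1 : set T1 -> \bar R)
    (mu2 : {measure set T2 -> \bar R}) D1 D2 (h1 : T1 -> R) (h2 : T2 -> R) :
  (forall s, 0 <= s -> measurable (D2 `&` [set x | s < `|h2 x|])) ->
  (forall s, 0 < s -> (distribution_function mu1 D1 h1 s <=
     distribution_function mu2 D2 h2 s)%E) ->
  forall t, (rearrangement mu1 D1 h1 t <= rearrangement mu2 D2 h2 t)%E.
Proof.
move=> mh2 h12 t; apply: le_ereal_inf_tmp => _ [s [s0 hs] <-].
apply/lee_addgt0Pr => e e0; apply: ge_ereal_inf; exists (s + e)%:E => //.
have se : 0 < s + e by rewrite ltr_wpDl.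
exists (s + e) => //; split; first exact: ltW.
apply: le_trans (h12 _ se) _; apply: le_trans hs.
by apply: distribution_function_antitone => //; rewrite lerDl ltW.
Qed.

(** * Symmetric spaces *)

Section symmetric_space_theory.
Variable R : realType.
Local Notation mu := (@lebesgue_measure R).
Local Notation I := (unit_interval R).
Variable Y : symmetric_space I.

Lemma measurable_gt_unit f s : measurable_fun I f ->
  measurable (I `&` [set x : R | (s < `|f x : R|)%R]).
Proof. by move=> mf; apply: measurable_gt => //; exact: measurable_unit_interval. Qed.

Lemma ss_norm0 : ss_norm Y (0 \*o (\1_`]0, 1[ : R -> R)) = 0.
Proof. by rewrite ss_norm_scale ?normr0 ?mul0r//; exact: ss_mem_unit. Qed.

(** From [0 = N (f - f) <= 2 N f]. *)
Lemma ss_norm_ge0 f : ss_mem Y f -> 0 <= ss_norm Y f.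
Proof.
move=> Yf.
have Ynf : ss_mem Y (-1 \*o f) by exact: ss_scale.
have := ss_norm_triangle Yf Ynf; rewrite ss_norm_scale// normrN1 mul1r.
suff -> : ss_norm Y (f \+ (-1 \*o f)) = 0 by rewrite -mulr2n pmulrn_lge0.
have -> : f \+ (-1 \*o f) = 0 \*o f.
  by apply/funext => x /=; rewrite mulN1r subrr mul0r.
by rewrite ss_norm_scale// normr0 mul0r.
Qed.

Lemma ss_le (f g : R -> R) : ss_mem Y f -> measurable_fun I g ->
  (forall s, 0 < s -> (distribution_function mu I g s <=
     distribution_function mu I f s)%E) ->
  ss_mem Y g /\ ss_norm Y g <= ss_norm Y f.
Proof.
move=> Yf mg gf; apply: ss_symm => // t _; apply: le_rearrangement => // s s0.
by apply: measurable_gt_unit; exact: ss_measurable Yf.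
Qed.

Lemma ss_norm_le (f g : R -> R) : ss_mem Y f -> measurable_fun I g ->
  (forall x, I x -> `|g x| <= `|f x|) ->
  ss_mem Y g /\ ss_norm Y g <= ss_norm Y f.
Proof.
move=> Yf mg gf; apply: ss_le => // s s0; apply: le_measure; rewrite ?inE.
- exact: measurable_gt_unit.
- by apply: measurable_gt_unit; exact: ss_measurable Yf.
- by move=> x [Ix /= sg]; split=> //=; apply: lt_le_trans sg _; exact: gf.
Qed.

Lemma ss_add_le f g a b : ss_mem Y f -> ss_mem Y g ->
  ss_norm Y f <= a -> ss_norm Y g <= b ->
  ss_mem Y (f \+ g) /\ ss_norm Y (f \+ g) <= a + b.
Proof.
move=> Yf Yg fa gb; split; first exact: ss_add.
by apply: le_trans (ss_norm_triangle Yf Yg) _; exact: lerD.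
Qed.

Lemma ss_scale_le f (c a : R) : 0 <= c -> ss_mem Y f -> ss_norm Y f <= a ->
  ss_mem Y (c \*o f) /\ ss_norm Y (c \*o f) <= c * a.
Proof.
move=> c0 Yf fa; split; first exact: ss_scale.
by rewrite ss_norm_scale// ger0_norm// ler_wpM2l.
Qed.

Lemma ss_sum_le n (f : nat -> R -> R) a : (forall k, ss_mem Y (f k)) ->
  (forall k, ss_norm Y (f k) <= a) ->
  ss_mem Y (fun x => \sum_(k < n) f k x) /\
  ss_norm Y (fun x => \sum_(k < n) f k x) <= n%:R * a.
Proof.
move=> Yf fa; elim: n => [|n [Yn na]].
  have -> : (fun x => \sum_(k < 0) f k x) = 0 \*o (\1_`]0, 1[ : R -> R).
    by apply/funext => x; rewrite big_ord0/= mul0r.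
  by rewrite ss_norm0 mul0r; split=> //; apply: ss_scale; exact: ss_mem_unit.
have -> : (fun x => \sum_(k < n.+1) f k x) =
    (fun x => \sum_(k < n) f k x) \+ f n.
  by apply/funext => x; rewrite big_ord_recr.
by rewrite -natr1 mulrDl mul1r; exact: ss_add_le.
Qed.

Lemma ext_normP g : (ext_norm Y g < +oo)%E ->
  [/\ {ae mu, forall x, I x -> g x \is a fin_num}, ss_mem Y (fine \o g) &
    ext_norm Y g = (ss_norm Y (fine \o g))%:E].
Proof. by rewrite /ext_norm; case: asboolP => // -[]. Qed.

Lemma ext_normE f : ss_mem Y f -> ext_norm Y (EFin \o f) = (ss_norm Y f)%:E.
Proof.
move=> Yf; rewrite /ext_norm; case: asboolP => // -[]; split=> //.
by apply: aeW.
Qed.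

Lemma ext_norm_le f a : ss_mem Y f /\ ss_norm Y f <= a ->
  (ext_norm Y (EFin \o f) <= a%:E)%E.
Proof. by move=> [Yf fa]; rewrite ext_normE// lee_fin. Qed.

Lemma ss_cst (c : R) : ss_mem Y (fun=> c) /\ ss_norm Y (fun=> c) <= `|c|.
Proof.
have [Y1 n1] : ss_mem Y (fun=> 1) /\ ss_norm Y (fun=> 1) <= 1.
  rewrite -[leRHS](ss_norm_unit Y); apply: ss_le; first exact: ss_mem_unit.
    exact: measurable_cst.
  move=> s s0; rewrite /distribution_function normr1.
  case: (ltP s 1) => s1; last first.
    rewrite (_ : _ `&` _ = set0) ?measure0//.
    by apply/seteqP; split=> x //= -[].
  apply: (@le_trans _ _ (mu `]0, 1[)).
    rewrite lebesgue_measure_itv/= lte_fin ltr01 sube0 -lebesgue_unit_interval.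
    apply: le_measure; rewrite ?inE.
    - rewrite (_ : _ `&` _ = I); first exact: measurable_unit_interval.
      by apply/seteqP; split=> x // [].
    - exact: measurable_unit_interval.
    - by move=> x [].
  apply: le_measure; rewrite ?inE; first exact: measurable_itv.
    by apply: measurable_gt_unit; exact: ss_measurable (ss_mem_unit Y).
  move=> x x01; split; first exact: subset_itv_oo_cc.
  by rewrite /= indicE mem_set//= normr1.
have -> : (fun=> c) = c \*o (fun=> 1) :> (R -> R).
  by apply/funext => x; rewrite /= mulr1.
split; first exact: ss_scale.
by rewrite ss_norm_scale// -[leRHS]mulr1 ler_wpM2l.
Qed.

Section dilation.
Context d (T : measurableType d) (P : {measure set T -> \bar R}).
Variables (D : set T) (h : T -> R).
Hypothesis mh : forall s, 0 <= s -> measurable (D `&` [set x | s < `|h x|]).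
Local Notation V := (fine \o rearrangement P D h).

Hypothesis fin_rearr :
  {ae mu, forall x, I x -> rearrangement P D h x \is a fin_num}.

(** By monotonicity, an infinite value at [t] would be taken on all of
    [(0, t)]. *)
Lemma rearrangement_fin t : 0 < t <= 1 ->
  rearrangement P D h t \is a fin_num.
Proof.
move=> /andP[t0 t1]; rewrite ge0_fin_numE; last exact: rearrangement_ge0.
apply: contrapT => /negP; rewrite -leNgt leye_eq => /eqP ht.
have [A [mA A0 NA]] := fin_rearr.
have : (mu `]0%R, t[ <= mu A)%E.
  apply: le_measure; rewrite ?inE//.
  move=> x /=; rewrite in_itv/= => /andP[x0 xt]; apply: NA => /=.
  apply/not_implyP; split.
    by rewrite /unit_interval/= in_itv/= (ltW x0) (le_trans (ltW xt) t1).
  have : (rearrangement P D h t <= rearrangement P D h x)%E.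
    by apply: rearrangement_antitone; exact: ltW.
  by rewrite ht leye_eq => /eqP ->.
by rewrite A0 lebesgue_measure_itv/= lte_fin t0 sube0 leNgt lte_fin t0.
Qed.

Lemma lt_fine_rearrangement s t : 0 <= s -> 0 < t <= 1 ->
  (s < `|V t|) = (t%:E < distribution_function P D h s)%E.
Proof.
move=> s0 t01; rewrite -(lt_rearrangement P mh)//.
rewrite -[in RHS](fineK (rearrangement_fin t01)) lte_fin ger0_norm//.
exact/fine_ge0/rearrangement_ge0.
Qed.

Lemma lebesgue_measure_itv_from (a c : R) b : 0 <= c ->
  mu [set` Interval (BRight a) (BSide b (a + c))] = c%:E.
Proof.
move=> c0; rewrite lebesgue_measure_itv/= lte_fin ltrDl lt_def c0 andbT.
by case: eqP => [->//|_]/=; rewrite -EFinB addrAC subrr add0r.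
Qed.

Lemma measure_translated_itv (a b : R) (t : \bar R) : 0 <= b -> (0 <= t)%E ->
  mu [set x | a < x <= a + b /\ ((x - a)%:E < t)%E] = Order.min t b%:E.
Proof.
move=> b0; case: t => [t| |]//.
  rewrite lee_fin => t0; case: (leP t b) => [tb|bt].
    rewrite min_l ?lee_fin//.
    rewrite (_ : [set x | _] = `]a, a + t[%classic).
      exact: lebesgue_measure_itv_from.
    apply/seteqP; split => x /=; rewrite in_itv/= lte_fin ltrBlDl.
      by move=> [/andP[-> _] ->].
    move=> /andP[ax xt]; rewrite ax xt; split=> //=.
    by rewrite (le_trans (ltW xt))// lerD2l.
  rewrite min_r ?lee_fin ?(ltW bt)//.
  rewrite (_ : [set x | _] = `]a, a + b]%classic).
    exact: lebesgue_measure_itv_from.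
  apply/seteqP; split => x /=; rewrite in_itv/= lte_fin ltrBlDl.
    by move=> [].
  move=> /[dup] axb /andP[ax xb]; split=> //.
  by apply: le_lt_trans xb _; rewrite ltrD2l.
move=> _; rewrite min_r ?leey//.
rewrite (_ : [set x | _] = `]a, a + b]%classic).
  exact: lebesgue_measure_itv_from.
apply/seteqP; split => x /=; rewrite in_itv/= ?ltry//.
by move=> [].
Qed.

Lemma measurable_translated_itv (a b : R) (t : \bar R) :
  measurable [set x | a < x <= a + b /\ ((x - a)%:E < t)%E].
Proof.
rewrite (_ : [set x | _] = `]a, a + b] `&` [set x | ((x - a)%:E < t)%E]).
  apply: measurableI; first exact: measurable_itv.
  case: t => [t| |].
  - rewrite (_ : [set x | _] = `]-oo, a + t[%classic); first exact: measurable_itv.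
    by apply/seteqP; split => x /=; rewrite in_itv/= lte_fin ltrBlDl.
  - rewrite (_ : [set x | _] = setT); first exact: measurableT.
    by apply/seteqP; split => x //= _; rewrite ltry.
  - rewrite (_ : [set x | _] = set0); first exact: measurable0.
    by apply/seteqP; split => x.
by apply/seteqP; split => x /=; rewrite in_itv.
Qed.

Hypothesis YV : ss_mem Y V.
Local Notation dh := (distribution_function P D h).

(** On [(0, 1]] the set where [V] exceeds [s] is the interval [(0, dh s)]. *)
Lemma min_le_distribution_rearrangement s : 0 <= s ->
  (Order.min (dh s) 1%:E <= distribution_function mu I V s)%E.
Proof.
move=> s0; rewrite -(@measure_translated_itv 0 1)//.
apply: le_measure; rewrite ?inE.
- exact: measurable_translated_itv.
- by apply: measurable_gt_unit; exact: ss_measurable YV.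
move=> x /=; rewrite add0r subr0 => -[x01 xd].
rewrite lt_fine_rearrangement// /unit_interval/= in_itv/=.
by have /andP[x0 ->] := x01; rewrite ltW.
Qed.

(** The only point of [I] that escapes the previous description is [0], where
    [V] may have any value. *)
Lemma distribution_rearrangement s : 0 <= s ->
  distribution_function mu I V s = Order.min (dh s) 1%:E.
Proof.
move=> s0; apply/eqP; rewrite eq_le min_le_distribution_rearrangement// andbT.
rewrite -(@measure_translated_itv 0 1)//.
set A := [set x | _ /\ _].
have mA : measurable A by exact: measurable_translated_itv.
apply: (@le_trans _ _ (mu A + mu [set (0%R : R)])%E); last first.
  by rewrite lebesgue_measure_set1 adde0.
apply: le_trans _ (measureU2 mu mA (measurable_set1 (0 : R))).
apply: le_measure; rewrite ?inE.
- by apply: measurable_gt_unit; exact: ss_measurable YV.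
- by apply: measurableU.
move=> x [/=]; rewrite /unit_interval/= in_itv/= => /andP[x0 x1] sx.
have [->|xn0] := eqVneq x 0; first by right.
have {x0} x0 : 0 < x by rewrite lt_def xn0.
left; rewrite /A/= add0r subr0 x0 x1; split=> //.
by rewrite -lt_fine_rearrangement// x0.
Qed.

Variable N : nat.
Hypothesis N0 : (0 < N)%N.

(** The largest values of [h], carried by the [i]-th interval of length
    [1 / N]. *)
Definition piece (i : nat) : R -> R :=
  (fun x => V (x - i%:R / N%:R)) \_ `]i%:R / N%:R, i%:R / N%:R + N%:R^-1].

Lemma piece_itv i x : (i < N)%N -> i%:R / N%:R < x <= i%:R / N%:R + N%:R^-1 ->
  I x /\ 0 < x - i%:R / N%:R <= 1.
Proof.
move=> iN /andP[ix xi].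
have NR : 0 < N%:R :> R by rewrite ltr0n.
have i0 : 0 <= i%:R / N%:R :> R by rewrite divr_ge0.
have i1 : i%:R / N%:R + N%:R^-1 <= 1 :> R.
  by rewrite -[X in _ + X]mul1r -mulrDl ler_pdivrMr// mul1r natr1 ler_nat.
rewrite /unit_interval/= in_itv/=; split; first by apply/andP; split; lra.
by apply/andP; split; lra.
Qed.

Lemma piece_event i s : (i < N)%N -> 0 <= s ->
  I `&` [set x | s < `|piece i x|] =
  [set x | i%:R / N%:R < x <= i%:R / N%:R + N%:R^-1 /\
    ((x - i%:R / N%:R)%:E < dh s)%E].
Proof.
move=> iN s0; apply/seteqP; split => x /=.
  move=> [Ix]; rewrite /piece patchE; case: ifPn; last first.
    by rewrite normr0 ltNge s0.
  rewrite inE/= in_itv/= => xi; have [_ x01] := piece_itv iN xi.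
  by rewrite lt_fine_rearrangement.
move=> [xi xd]; have [Ix x01] := piece_itv iN xi; split=> //.
by rewrite /piece patchE mem_set ?lt_fine_rearrangement//= in_itv.
Qed.

Lemma measurable_piece i : (i < N)%N -> measurable_fun I (piece i).
Proof.
move=> iN; apply: (@measurable_funS _ _ _ _ setT) => //.
apply/(measurable_restrictT _ _).1 => //.
apply: (@measurable_comp _ _ _ _ _ _ I V).
- exact: measurable_unit_interval.
- move=> y [x /=]; rewrite in_itv/= => xi <-.
  have [_ /andP[x0 x1]] := piece_itv iN xi.
  by rewrite /unit_interval/= in_itv/= x1 ltW.
- exact: ss_measurable YV.
- exact: measurable_funB.
Qed.

Lemma ss_piece i : (i < N)%N ->
  ss_mem Y (piece i) /\ ss_norm Y (piece i) <= ss_norm Y V.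
Proof.
move=> iN; apply: ss_le => //; first exact: measurable_piece.
move=> s s0; apply: le_trans (min_le_distribution_rearrangement (ltW s0)).
rewrite /distribution_function piece_event ?(ltW s0)//.
rewrite measure_translated_itv ?invr_ge0 ?measure_ge0//.
rewrite le_min; apply/andP; split; first by rewrite ge_min lexx.
rewrite ge_min; apply/orP; right; rewrite lee_fin invf_le1 ?ltr0n//.
by rewrite ler1n.
Qed.

(** The pieces [piece 0, ..., piece (N - 1)] have disjoint supports and fill [I]:
    the tail of their sum is [N] times the tail of [h], cut off at [1], while
    each of them has norm at most that of [V]. *)
Lemma ss_dilation (u : R -> R) (a : R) : measurable_fun I u -> 0 < a ->
  (forall s, 0 < s ->
    (distribution_function mu I u s <= N%:R%:E * dh (s / a)%R)%E) ->
  ss_mem Y u /\ ss_norm Y u <= a * (N%:R * ss_norm Y V).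
Proof.
move=> mu_ a0 udh.
pose f i := piece (minn i N.-1).
have iN i : (minn i N.-1 < N)%N by rewrite gtn_min prednK// leqnn orbT.
have [YW nW] := @ss_sum_le N f _ (fun k => proj1 (ss_piece (iN k)))
  (fun k => proj2 (ss_piece (iN k))).
set W := (fun x => _) in YW nW.
have [YaW naW] := ss_scale_le (ltW a0) YW nW.
suff [Yu nu] : ss_mem Y u /\ ss_norm Y u <= ss_norm Y (a \*o W).
  by split=> //; exact: le_trans naW.
apply: ss_le => // s s0.
have sa0 : 0 < s / a by rewrite divr_gt0.
have mW : measurable (I `&` [set x | s / a < `|W x|]).
  by apply: measurable_gt_unit; exact: ss_measurable YW.
have -> : distribution_function mu I (a \*o W) s =
    distribution_function mu I W (s / a).
  congr (mu (_ `&` _)); apply/seteqP; split => x /=;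
  by rewrite normrM (gtr0_norm a0) ltr_pdivrMr// mulrC.
apply: (@le_trans _ _ (Order.min (N%:R%:E * dh (s / a)%R) 1%:E)%E).
  rewrite le_min udh//= -lebesgue_unit_interval; apply: le_measure; rewrite ?inE//.
    exact: measurable_gt_unit.
  exact: measurable_unit_interval.
apply: (@le_trans _ _ (\sum_(i < N) Order.min (dh (s / a)%R) (N%:R^-1)%:E)%E).
  have : (0 <= dh (s / a)%R)%E by exact: measure_ge0.
  case: (dh (s / a)) => [r| |].
  - move=> _; under eq_bigr do rewrite -EFin_min.
    rewrite sumEFin sumr_const card_ord -EFinM -EFin_min lee_fin.
    case: (leP r N%:R^-1) => _; first by rewrite mulr_natl ge_min lexx.
    by rewrite -[N%:R^-1 *+ N]mulr_natr mulVf ?ge_min ?lexx ?orbT// pnatr_eq0 -lt0n.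
  - move=> _; under eq_bigr do rewrite min_r ?leey//.
    rewrite sumEFin sumr_const card_ord.
    rewrite -[N%:R^-1 *+ N]mulr_natr mulVf ?pnatr_eq0 -?lt0n//.
    by rewrite ge_min lexx orbT.
  - by rewrite leeNy_eq.
rewrite (eq_bigr (fun i : 'I_N => mu (I `&` [set x | s / a < `|piece i x|]))); last first.
  move=> i _; rewrite piece_event ?(ltW sa0)//.
  by rewrite measure_translated_itv ?invr_ge0 ?measure_ge0.
have disj x (i j : 'I_N) : s / a < `|piece i x| -> s / a < `|piece j x| -> i = j.
  have itv k : s / a < `|piece k x| -> k%:R < x * N%:R <= k%:R + 1.
    rewrite /piece patchE; case: ifPn; last by rewrite normr0 ltNge ltW.
    rewrite inE/= in_itv/= ltr_pdivrMr ?ltr0n// => /andP[-> xk] _ /=.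
    by rewrite -ler_pdivlMr ?ltr0n// mulrDl mul1r.
  move=> /itv/andP[ix xi] /itv/andP[jx xj]; apply/val_inj/eqP => /=.
  have ij := lt_le_trans ix xj; have ji := lt_le_trans jx xi.
  by move: ij ji; rewrite !natr1 !ltr_nat !ltnS => ij ji; rewrite eqn_leq ij.
apply: sum_measure_le.
- exact: index_enum_uniq.
- exact: mW.
- by move=> i _; apply: measurable_gt_unit; exact: measurable_piece.
- move=> i _ x [Ix /= sx]; split=> //=; apply: lt_le_trans sx _.
  have p0 k : 0 <= piece k x.
    rewrite /piece patchE; case: ifP => // _.
    exact/fine_ge0/rearrangement_ge0.
  rewrite !ger0_norm ?sumr_ge0//; last by move=> k _; exact: p0.
  rewrite /W (bigD1 i)//= /f.
  have -> : minn i N.-1 = i by apply/minn_idPl; rewrite -ltnS prednK.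
  by rewrite lerDl sumr_ge0// => k _; exact: p0.
- by move=> i j x _ _ [_ si] [_ sj]; exact: disj si sj.
Qed.

End dilation.
End symmetric_space_theory.

(** * The norm of the Kruglov operator *)

Section kruglov_norm_theory.
Variables (R : realType) (P : probability (sequence_space R) R).
Variable B : nat -> set R.
Hypotheses (HP : is_product_measure P) (HB : kruglov_sets B).
Local Notation mu := (@lebesgue_measure R).
Local Notation I := (unit_interval R).
Local Notation cube := (cube R : set (sequence_space R)).
Variables X Y : symmetric_space I.
Hypothesis XY : ss_mem X `<=` ss_mem Y.
Hypothesis Kfin : (kruglov_norm P B X Y < +oo)%E.
Local Notation kappa := (fine (kruglov_norm P B X Y)).
Local Notation c := (fine (inclusion_norm X Y)).

Lemma kruglov_scale (a : R) f w : kruglov B (a \*o f) w = a * kruglov B f w.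
Proof.
have [[m m0 Bm]|nB] := pselect (exists2 m, (0 < m)%N & B m (w 0%N)).
  by rewrite !(kruglovE HB _ m0 Bm) mulr_sumr.
by rewrite !kruglov0 ?mulr0// => m m0 Bm; apply: nB; exists m.
Qed.

Lemma ext_norm_ge0 (Z : symmetric_space I) g : (0 <= ext_norm Z g)%E.
Proof.
by rewrite /ext_norm; case: asboolP => [[_ Zg]|_]; rewrite ?leey// lee_fin ss_norm_ge0.
Qed.

Lemma unit_ball_unit : unit_ball X (\1_`]0, 1[ : R -> R).
Proof. by split; [exact: ss_mem_unit|rewrite ss_norm_unit]. Qed.

Lemma kruglov_norm_fin : kruglov_norm P B X Y = kappa%:E.
Proof.
rewrite fineK// ge0_fin_numE//; apply: le_trans (ext_norm_ge0 Y _) _.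
by apply: ereal_sup_ubound; exists (\1_`]0, 1[); first exact: unit_ball_unit.
Qed.

(** This is how the boundedness of [K] is used: [f / z] lies in the unit ball,
    and a tail bound by the image of [f] is a tail bound by the image of [f / z],
    to which dilation applies. *)
Lemma ss_le_kruglov f z u a : ss_mem X f -> 0 < z -> ss_norm X f <= z ->
  measurable_fun I u -> 0 < a ->
  (forall s, 0 < s -> (distribution_function mu I u s <=
    4%:E * distribution_function P cube (kruglov B f) (s / a)%R)%E) ->
  ss_mem Y u /\ ss_norm Y u <= 4 * a * z * kappa.
Proof.
move=> Xf z0 fz mu_ a0 uf.
pose f' := z^-1 \*o f.
have Bf' : unit_ball X f'.
  split; first exact: ss_scale.
  by rewrite ss_norm_scale// gtr0_norm ?invr_gt0// ler_pdivrMl// mulr1.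
have le_kappa : (ext_norm Y (rearrangement P cube (kruglov B f')) <= kappa%:E)%E.
  by rewrite -kruglov_norm_fin; apply: ereal_sup_ubound; exists f'.
have [finV YV extE] := ext_normP (le_lt_trans le_kappa (ltry _)).
rewrite extE lee_fin in le_kappa.
have mh s : 0 <= s -> measurable (cube `&` [set w | s < `|kruglov B f' w|]).
  by move=> s0; apply: measurable_kruglov_event => //; apply: ss_measurable (proj1 Bf').
have az : 0 < a * z by rewrite mulr_gt0.
have [|Yu nu] := @ss_dilation _ Y _ _ P cube _ mh finV YV 4 isT u (a * z) mu_ az.
  move=> s s0; apply: le_trans (uf s s0) _; apply: lee_wpmul2l => //.
  rewrite le_eqVlt; apply/orP; left; apply/eqP; congr (P (_ `&` _)).
  have sazE : s / (a * z) = z^-1 * (s / a) by rewrite invfM; ring.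
  have zV0 : 0 < z^-1 by rewrite invr_gt0.
  apply/seteqP; split => w /=;
  by rewrite /f' kruglov_scale normrM (gtr0_norm zV0) sazE ltr_pM2l.
split=> //; apply: le_trans nu _.
by rewrite [4 * a * z * _](_ : _ = a * z * (4 * kappa)); [rewrite !ler_pM2l|ring].
Qed.

(** With probability [1 / e] there is exactly one jump, and then the image is
    a copy of [f]. *)
Lemma distribution_le_kruglov f s : ss_mem X f -> 0 < s ->
  (distribution_function mu I f s <=
    4%:E * distribution_function P cube (kruglov B f) (s / 1)%R)%E.
Proof.
move=> Xf s0; rewrite divr1; have mf := ss_measurable Xf.
have h := @jump_event_le _ P _ HB f s 1 isT (ltW s0) mf.
apply: (@le_trans _ _ (4%:E * P (jump_event B f s 1))%E); last exact: lee_wpmul2l.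
have mA : measurable (I `&` [set x | s < `|f x|]) by exact: measurable_gt_unit.
have := @rectangle_le_jump_event _ P _ HP HB f s 1
  (fun=> I `&` [set x | s < `|f x|]) isT mf (fun=> mA).
rewrite big_ord1 setIA setIid (_ : 1`! = 1%N)// mulr1 => h'.
apply: le_trans (lee_wpmul2l _ (h' _)) => //; last first.
  by move=> w cw /(_ 0%N isT)[_]; rewrite big_nat1.
rewrite muleA -EFinM -[leLHS]mul1e; apply: lee_wpmul2r; first exact: measure_ge0.
by rewrite lee_fin ler_pdivlMr ?expR_gt0// mul1r expR1_le4.
Qed.

(** As [K f] contains a copy of [f], the operator [K] controls the inclusion of
    [X] into [Y]; since that inclusion has norm at least [1], the norm of [K]
    stays away from [0]. *)
Lemma inclusion_norm_le : (inclusion_norm X Y <= (4 * kappa)%:E)%E.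
Proof.
apply: ge_ereal_sup => _ [f [Xf f1] <-]; apply: ext_norm_le.
have := ss_le_kruglov Xf ltr01 f1 (ss_measurable Xf) ltr01.
by rewrite !mulr1; apply => s s0; exact: distribution_le_kruglov.
Qed.

Lemma inclusion_norm_ge1 : (1%:E <= inclusion_norm X Y)%E.
Proof.
rewrite -(ss_norm_unit Y) -ext_normE; last exact: ss_mem_unit.
by apply: ereal_sup_ubound; exists (\1_`]0, 1[); first exact: unit_ball_unit.
Qed.

Lemma inclusion_norm_fin : inclusion_norm X Y = c%:E.
Proof.
rewrite fineK// ge0_fin_numE; last exact: le_trans inclusion_norm_ge1.
exact: le_lt_trans inclusion_norm_le (ltry _).
Qed.

Lemma inclusion_ge1 : 1 <= c.
Proof. by rewrite -lee_fin -inclusion_norm_fin inclusion_norm_ge1. Qed.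

Lemma kruglov_norm_gt0 : 0 < kappa.
Proof.
have : (1%:E <= (4 * kappa)%:E)%E.
  exact: le_trans inclusion_norm_ge1 inclusion_norm_le.
by rewrite lee_fin; lra.
Qed.

Lemma ss_norm_inclusion f z : ss_mem X f -> 0 < z -> ss_norm X f <= z ->
  ss_mem Y f /\ ss_norm Y f <= c * z.
Proof.
move=> Xf z0 fz; split; first exact: XY.
have Bf : unit_ball X (z^-1 \*o f).
  split; first exact: ss_scale.
  by rewrite ss_norm_scale// gtr0_norm ?invr_gt0// ler_pdivrMl// mulr1.
have : (ext_norm Y (EFin \o (z^-1 \*o f)) <= c%:E)%E.
  by rewrite -inclusion_norm_fin; apply: ereal_sup_ubound; exists (z^-1 \*o f).
rewrite ext_normE ?lee_fin; last by apply: XY; case: Bf.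
by rewrite ss_norm_scale ?gtr0_norm ?invr_gt0//; [rewrite ler_pdivrMl// mulrC|exact: XY].
Qed.

End kruglov_norm_theory.

(** * Disjointifications and the rearrangement of [F] *)

Section cell_measure.
Context d1 (T1 : measurableType d1) d2 (T2 : measurableType d2) (R : realType).
Variables (mu1 : {measure set T1 -> \bar R}) (mu2 : {measure set T2 -> \bar R}).
Variables (D1 : set T1) (D2 : set T2) (h1 : T1 -> R) (h2 : T2 -> R).
Hypothesis mh1 : forall s, 0 <= s -> measurable (D1 `&` [set x | s < `|h1 x|]).
Hypothesis mh2 : forall s, 0 <= s -> measurable (D2 `&` [set x | s < `|h2 x|]).

(** The measure of a cell is a difference of two tails, the first of them
    finite. *)
Lemma measure_cell_eq a b : 0 <= a ->
  (distribution_function mu1 D1 h1 a < +oo)%E ->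
  (forall s, a <= s -> distribution_function mu1 D1 h1 s =
    distribution_function mu2 D2 h2 s) ->
  mu1 (D1 `&` [set x | cell a b `|h1 x|]) = mu2 (D2 `&` [set x | cell a b `|h2 x|]).
Proof.
move=> a0 fin1 h12.
have cellD d (T : measurableType d) (mu : {measure set T -> \bar R})
    (D : set T) (h : T -> R) r :
    (forall s, 0 <= s -> measurable (D `&` [set x | s < `|h x|])) ->
    (distribution_function mu D h a < +oo)%E -> a <= r ->
    mu (D `&` [set x | cell a r%:E `|h x|]) =
    (distribution_function mu D h a - distribution_function mu D h r)%E.
  move=> mh fin ar; have r0 : 0 <= r by exact: le_trans ar.
  rewrite (_ : D `&` _ =
      (D `&` [set x | a < `|h x|]) `\` (D `&` [set x | r < `|h x|])); last first.
    apply/seteqP; split => x /=.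
      move=> [Dx [ah]]; rewrite lee_fin => hr; split=> // -[_].
      by rewrite ltNge hr.
    move=> [[Dx ah] hr]; split=> //; split=> //.
    by rewrite lee_fin leNgt; apply/negP => rh; exact: hr.
  rewrite measureD//; [|exact: mh|exact: mh].
  congr (_ - mu _)%E; apply/setIidr => x [Dx /= rh]; split=> //=.
  exact: le_lt_trans rh.
case: b => [r| |].
- case: (leP a r) => ar; first by rewrite !cellD// ?h12// -h12.
  have e d (T : measurableType d) (D : set T) (h : T -> R) :
      D `&` [set x | cell a r%:E `|h x|] = set0.
    apply/seteqP; split => x //= [_ [ah]]; rewrite lee_fin => hr.
    by have := lt_trans ar (lt_le_trans ah hr); rewrite ltxx.
  by rewrite !e !measure0.
- have e d (T : measurableType d) (D : set T) (h : T -> R) :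
      D `&` [set x | cell a +oo `|h x|] = D `&` [set x | a < `|h x|].
    apply/seteqP; split => x /= [Dx]; first by move=> [].
    by move=> ah; split=> //; split=> //; rewrite leey.
  by rewrite !e; exact: h12.
- have e d (T : measurableType d) (D : set T) (h : T -> R) :
      D `&` [set x | cell a -oo `|h x|] = set0.
    by apply/seteqP; split => x //= [_ []]; rewrite leeNy_eq.
  by rewrite !e !measure0.
Qed.

End cell_measure.

Section disjointification.
Variable R : realType.
Local Notation mu := (@lebesgue_measure R).
Local Notation I := (unit_interval R).
Local Notation H := (half_line R).

Lemma measurable_half_line : measurable H.
Proof. exact: measurable_itv. Qed.

Lemma measurable_cell_norm (D : set R) (h : R -> R) a b : measurable D ->
  measurable_fun D h -> measurable (D `&` [set x : R | cell a b `|h x|]).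
Proof.
move=> mD mh; have : measurable_fun D (fun x => `|h x|) by exact: measurableT_comp.
by apply => //; exact: measurable_cell.
Qed.

Lemma distribution_unit_le1 (f : R -> R) s : measurable_fun I f ->
  (distribution_function mu I f s <= 1%:E)%E.
Proof.
move=> mf; rewrite -lebesgue_unit_interval; apply: le_measure; rewrite ?inE//.
  exact: measurable_gt_unit.
exact: measurable_unit_interval.
Qed.

(** Where [|F|] is positive it agrees with exactly one of the [|fbar_k|], whose
    supports are disjoint. *)
Lemma disjointification_cell (f : nat -> R -> R) F n (a : R) b :
  (forall k, measurable_fun I (f k)) -> disjointification f F -> 0 <= a ->
  (\sum_(k < n) mu (I `&` [set x | cell a b `|f k x|%R])
    <= mu (H `&` [set x | cell a b `|F x|%R]))%E.
Proof.
move=> mf [mF [fbar [mfbar tfbar eqf [A [mA A0 AF]]]]] a0.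
have mHF : measurable (H `&` [set x : R | cell a b `|F x|%R]).
  by apply: measurable_cell_norm => //; exact: measurable_half_line.
pose G k := H `&` [set x : R | cell a b `|fbar k x|].
have mG k : measurable (G k).
  by apply: measurable_cell_norm => //; exact: measurable_half_line.
have uniqG i j x : G i x -> fbar j x != 0 -> i = j.
  move=> [Hx [ai _]] j0; apply: (tfbar i j) => //; exists x.
  have i0 : fbar i x != 0 by rewrite -normr_gt0 (le_lt_trans a0).
  by split; split.
have -> : (\sum_(k < n) mu (I `&` [set x | cell a b `|f k x|%R]) =
    \sum_(k < n) mu (G k))%E.
  apply: eq_bigr => k _; apply: measure_cell_eq => //.
  - by move=> s _; exact: measurable_gt_unit.
  - by move=> s _; apply: measurable_gt => //; exact: measurable_half_line.
  - exact: le_lt_trans (distribution_unit_le1 _ (mf k)) (ltry _).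
  - by move=> s as_; rewrite (eqf k)// (le_trans a0).
apply: (@le_trans _ _ (mu ((H `&` [set x | cell a b `|F x|%R]) `|` A))); last first.
  apply: le_trans (measureU2 mu mHF mA) _.
  by rewrite [X in (_ + X)%E](_ : _ = 0%E) ?adde0.
apply: sum_measure_le.
- exact: index_enum_uniq.
- exact: measurableU.
- by move=> k _; exact: mG.
- move=> k _ x Gx; have [Ax|nAx] := pselect (A x); first by right.
  left; have [Hx hk] := Gx; split=> //=.
  have -> : F x = fbar k x; last by [].
  have -> : F x = \big[+%R/0]_(0 <= k <oo) fbar k x.
    by apply: contrapT => Fx; apply: nAx; apply: AF => /= /(_ Hx).
  apply: lim_near_cst => //; near=> N.
  rewrite (bigD1_seq (nat_of_ord k))/= ?iota_uniq//; last first.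
    by rewrite mem_index_iota/=; near: N; exact: nbhs_infty_gt.
  rewrite big1 ?addr0// => j jk; apply/eqP; apply: contraNT jk => j0.
  by rewrite (uniqG k j x).
- move=> i j x _ _ Gi [_ [aj _]]; apply/val_inj; apply: (uniqG i j x) => //.
  by rewrite -normr_gt0 (le_lt_trans a0).
Unshelve. all: by end_near. Qed.

Lemma disjointification_gt (f : nat -> R -> R) F n a :
  (forall k, measurable_fun I (f k)) -> disjointification f F -> 0 <= a ->
  (\sum_(k < n) mu (I `&` [set x | (a < `|f k x|)%R])
    <= distribution_function mu H F a)%E.
Proof.
move=> mf disjF a0.
have e (D : set R) (h : R -> R) :
    D `&` [set x | cell a +oo `|h x|] = D `&` [set x | a < `|h x|].
  apply/seteqP; split => x /= [Dx]; first by move=> [].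
  by move=> ah; split=> //; split=> //; rewrite leey.
have := disjointification_cell n +oo mf disjF a0.
by rewrite e; under eq_bigr do rewrite e.
Qed.

(** Above a level [z] where the tail of [F] is at most [1], the function [F] on
    the half-line and its rearrangement on the unit interval are
    indistinguishable. The bound [z] on the norm of the rearrangement provides
    such a level. *)
Section largest_values.
Variable X : symmetric_space I.
Variables (F : R -> R) (z : R).
Hypotheses (mF : measurable_fun H F) (z0 : 0 < z).
Hypothesis Fz :
  (ext_norm X ((rearrangement mu H F) \_ I) < z%:E)%E.
Local Notation V := (fine \o rearrangement mu H F).

Let mhF s : 0 <= s -> measurable (H `&` [set x | s < `|F x|]).
Proof. by move=> _; apply: measurable_gt => //; exact: measurable_half_line. Qed.

Lemma ae_rearrangement_fin :
  {ae mu, forall x, I x -> rearrangement mu H F x \is a fin_num}.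
Proof.
have [aeV _ _] := ext_normP (lt_trans Fz (ltry _)).
have [A [mA A0 AV]] := aeV; exists A; split=> // x /= nx; apply: AV => /= fx.
by apply: nx => Ix; have := fx Ix; rewrite patchE mem_set.
Qed.

Lemma ss_rearrangement : ss_mem X V /\ ss_norm X V < z.
Proof.
have [_ XV extE] := ext_normP (lt_trans Fz (ltry _)).
have VE x : I x -> V x = (fine \o ((rearrangement mu H F) \_ I)) x.
  by move=> Ix /=; rewrite patchE mem_set.
move: Fz; rewrite extE lte_fin => Vz.
have [XV' nV] : ss_mem X V /\
    ss_norm X V <= ss_norm X (fine \o ((rearrangement mu H F) \_ I)).
  apply: ss_norm_le => //; last by move=> x Ix; rewrite VE.
  apply: (eq_measurable_fun _ _ (ss_measurable XV)).
  by move=> x; rewrite inE => Ix; rewrite VE.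
by split=> //; exact: le_lt_trans nV Vz.
Qed.

Lemma rearrangement_ge0_fine x : 0 <= V x.
Proof. exact/fine_ge0/rearrangement_ge0. Qed.

(** Otherwise [V] would exceed [z] on the whole interval, and its norm would be
    at least [z]. *)
Lemma distribution_le1 : (distribution_function mu H F z <= 1%:E)%E.
Proof.
have [XV Vz] := ss_rearrangement.
rewrite leNgt; apply/negP => d1.
have : z <= ss_norm X V.
  have [X1 n1] := ss_scale_le (ltW z0) (ss_mem_unit X) (lexx _).
  have <- : ss_norm X (z \*o (\1_`]0, 1[ : R -> R)) = z.
    by rewrite ss_norm_scale ?ss_norm_unit ?mulr1 ?gtr0_norm//; exact: ss_mem_unit.
  suff [] : ss_mem X (z \*o (\1_`]0, 1[ : R -> R)) /\
    ss_norm X (z \*o (\1_`]0, 1[ : R -> R)) <= ss_norm X V by [].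
  apply: ss_norm_le => //; first exact: ss_measurable X1.
  move=> x Ix /=; rewrite indicE; case: (boolP (x \in _)) => [|_]; last first.
    by rewrite mulr0 normr0.
  rewrite inE/= in_itv/= => /andP[x0 x1].
  have x01 : 0 < x <= 1 by rewrite x0 (ltW x1).
  have zV : z < `|V x|.
    have /= -> := @lt_fine_rearrangement R _ _ mu H F mhF ae_rearrangement_fin _ _ (ltW z0) x01.
    by apply: lt_trans d1; rewrite lte_fin.
  by rewrite mulr1 (gtr0_norm z0); exact: ltW.
by rewrite leNgt Vz.
Qed.

Lemma distribution_rearrangement_ge s : z <= s ->
  distribution_function mu I V s = distribution_function mu H F s.
Proof.
move=> zs; have s0 : 0 <= s by rewrite (le_trans (ltW z0)).
have [XV _] := ss_rearrangement.
rewrite (@distribution_rearrangement _ _ _ _ mu H F mhF ae_rearrangement_fin XV)//.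
rewrite min_l//; apply: le_trans distribution_le1.
by apply: distribution_function_antitone => //; exact: ltW.
Qed.

Definition large_part (y : R) : R := if z < `|y| then `|y| else 0.

Lemma large_part_ge0 y : 0 <= large_part y.
Proof. by rewrite /large_part; case: ifP. Qed.

Lemma measurable_large_part : measurable_fun setT large_part.
Proof.
rewrite (_ : large_part = (fun y => `|y| * (\1_(`]z, +oo[) `|y|))).
  apply: measurable_funM; first exact: normr_measurable.
  apply: measurableT_comp; last exact: normr_measurable.
  by apply: measurable_indic; exact: measurable_itv.
apply/funext => y; rewrite /large_part indicE mem_setE in_itv/= andbT.
by case: ifP; rewrite ?mulr1 ?mulr0.
Qed.

Lemma large_part_cell (f : nat -> R -> R) n (a : R) b :
  (forall k, measurable_fun I (f k)) -> disjointification f F -> 0 < a ->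
  (\sum_(k < n) mu (I `&` (large_part \o f k) @^-1` cell a b)
    <= mu (I `&` V @^-1` cell a b))%E.
Proof.
move=> mf disjF a0; pose a' := Num.max a z.
have a'0 : 0 <= a' by rewrite le_max ltW.
have zle : z <= a' by rewrite le_max lexx orbT.
have -> : (\sum_(k < n) mu (I `&` (large_part \o f k) @^-1` cell a b) =
    \sum_(k < n) mu (I `&` [set x | cell a' b `|f k x|%R]))%E.
  apply: eq_bigr => k _; congr (mu (_ `&` _)); apply/seteqP; split => x /=.
    rewrite /large_part; case: ifP => zf [af fb].
      by split=> //; rewrite gt_max af zf.
    by move: af; rewrite ltNge ltW.
  by move=> [+ fb]; rewrite gt_max /large_part => /andP[af ->].
apply: le_trans (disjointification_cell n b mf disjF a'0) _.
have [XV _] := ss_rearrangement; have mV := ss_measurable XV.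
rewrite -(@measure_cell_eq _ _ _ _ _ mu mu I H V F)//.
- apply: le_measure; rewrite ?inE.
  + by apply: measurable_cell_norm => //; exact: measurable_unit_interval.
  + by apply: mV; [exact: measurable_unit_interval|exact: measurable_cell].
  + move=> x [Ix [/= ax xb]]; split=> //=.
    move: ax xb; rewrite ger0_norm ?rearrangement_ge0_fine//.
    by rewrite gt_max => /andP[ax _] xb.
- by move=> s _; exact: measurable_gt_unit.
- exact: le_lt_trans (distribution_unit_le1 _ mV) (ltry _).
- by move=> s as_; apply: distribution_rearrangement_ge; exact: le_trans as_.
Qed.

End largest_values.
End disjointification.

(** * Real powers *)

Section powers.
Variable R : realType.
Implicit Types (s t u r theta : R).

Lemma ler_powR2 r s t : 0 <= r -> 0 <= s -> s <= t -> s `^ r <= t `^ r.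
Proof.
by move=> r0 s0 st; apply: ge0_ler_powR; rewrite ?nnegrE// (le_trans s0).
Qed.

Lemma powRVK r t : 0 < r -> 0 <= t -> (t `^ r) `^ r^-1 = t.
Proof. by move=> r0 t0; rewrite -powRrM mulfV ?gt_eqF// powRr1. Qed.

Lemma powRKV r t : 0 < r -> 0 <= t -> (t `^ r^-1) `^ r = t.
Proof. by move=> r0 t0; rewrite -powRrM mulVf ?gt_eqF// powRr1. Qed.

Lemma ltr_powR_inv r u t : 0 < r -> 0 <= u -> 0 <= t ->
  (u < t `^ r) = (u `^ r^-1 < t).
Proof.
move=> r0 u0 t0; apply/idP/idP => ut.
  rewrite -(powRVK r0 t0); apply: gt0_ltr_powR; rewrite ?nnegrE ?invr_gt0//.
  exact: powR_ge0.
rewrite -(powRKV r0 u0); apply: gt0_ltr_powR; rewrite ?nnegrE//.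
exact: powR_ge0.
Qed.

(** Both sides are compared with the maximum of [s] and [t]. *)
Lemma powRM_le_add s t theta : 0 <= s -> 0 <= t -> 0 <= theta <= 1 ->
  s `^ (1 - theta) * t `^ theta <= s + t.
Proof.
move=> s0 t0 /andP[th0 th1].
pose m := Num.max s t.
have m0 : 0 <= m by rewrite le_max s0.
have m_le : m <= s + t by rewrite ge_max lerDl lerDr t0 s0.
apply: le_trans m_le.
apply: (@le_trans _ _ (m `^ (1 - theta) * m `^ theta)).
  apply: ler_pM; rewrite ?powR_ge0//; apply: ler_powR2; rewrite ?subr_ge0//.
    by rewrite le_max lexx.
  by rewrite le_max lexx orbT.
have [->|m_neq0] := eqVneq m 0.
  have [->|th] := eqVneq theta 0; first by rewrite powRr0 mulr1 subr0 powRr1.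
  by rewrite (powR0 th) mulr0.
by rewrite -powRD ?m_neq0 ?implybT// subrK powRr1.
Qed.

Lemma powR_le_add1 t theta : 0 <= t -> 0 <= theta <= 1 -> t `^ theta <= t + 1.
Proof.
by move=> t0 th; have := powRM_le_add ler01 t0 th; rewrite powR1 mul1r addrC.
Qed.

Lemma powRD_le s t theta : 0 <= s -> 0 <= t -> 0 <= theta <= 1 ->
  (s + t) `^ theta <= 2 * (s `^ theta + t `^ theta).
Proof.
move=> s0 t0 /andP[th0 th1].
pose m := Num.max s t.
have m0 : 0 <= m by rewrite le_max s0.
apply: (@le_trans _ _ ((2 * m) `^ theta)).
  apply: ler_powR2; rewrite ?addr_ge0//.
  by rewrite mulr_natl mulr2n lerD// le_max lexx ?orbT.
rewrite powRM//; apply: ler_pM; rewrite ?powR_ge0//.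
  by apply: ler1_powR => //; rewrite ler1n.
rewrite /m; case: (leP s t) => _; first by rewrite lerDr powR_ge0.
by rewrite lerDl powR_ge0.
Qed.

End powers.

(** * Integrals dominate sums of tails *)

Section integrals.
Context d (T : measurableType d) (R : realType) (mu : {measure set T -> \bar R}).
Variable D : set T.
Hypothesis mD : measurable D.

Lemma measurable_gt_const (p : T -> R) (s : R) : measurable_fun D p ->
  measurable (D `&` [set x | (s < p x)%R]).
Proof.
move=> mp; rewrite (_ : [set x | _] = p @^-1` [set` `]s, +oo[]).
  by apply: mp => //; exact: measurable_itv.
by apply/seteqP; split => x /=; rewrite in_itv/= andbT.
Qed.

(** The left-hand side is the integral of [delta * level delta L p]. *)
Lemma tail_sum_le_integral (p : T -> R) (delta : R) L :
  measurable_fun D p -> (forall x, D x -> 0 <= p x) -> 0 <= delta ->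
  (delta%:E * (\sum_(j < L) mu (D `&` [set x | (j.+1%:R * delta < p x)%R]))
    <= \int[mu]_(x in D) (p x)%:E)%E.
Proof.
move=> mp p0 d0.
pose A (j : nat) := D `&` [set x | (j.+1%:R * delta < p x)%R].
have mA j : measurable (A j) by exact: measurable_gt_const.
have mind j : measurable_fun D (fun x => (\1_(A j) x)%:E : \bar R).
  by apply/measurable_EFinP; exact: measurable_indic.
have -> : (delta%:E * \sum_(j < L) mu (D `&` [set x | (j.+1%:R * delta < p x)%R]) =
  \int[mu]_(x in D) (delta%:E * \sum_(j < L) (\1_(A j) x)%:E))%E.
  rewrite ge0_integralZl//; last first.
  - by move=> x _; apply: sume_ge0 => j _; rewrite lee_fin.
  - by apply: emeasurable_sum => j _; exact: mind.
  congr (_ * _)%E; rewrite ge0_integral_sum//.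
  apply: eq_bigr => j _; rewrite integral_indic//.
  by rewrite [in RHS]setIC /A setIA setIid.
apply: ge0_le_integral => //.
- move=> x _; rewrite mule_ge0 ?lee_fin//.
  by apply: sume_ge0 => j _; rewrite lee_fin.
- apply: emeasurable_funM; first exact: measurable_cst.
  by apply: emeasurable_sum => j _; exact: mind.
- exact/measurable_EFinP.
move=> x Dx; rewrite sumEFin -EFinM lee_fin.
apply: le_trans (level_mul_le L d0 (p0 x Dx)).
rewrite mulrC; apply: ler_wpM2r => //; rewrite /level natr_sum.
rewrite le_eqVlt; apply/orP; left; apply/eqP; apply: eq_bigr => j _.
rewrite indicE; congr (_%:R); rewrite (_ : (x \in A j) = (j.+1%:R * delta < p x))//.
by apply/idP/idP; rewrite inE /A/=; [case|].
Qed.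

Lemma integral_powR_le (h : T -> R) (r z : R) : 0 < r -> 0 <= z ->
  ('N[mu]_r%:E[(EFin \o h) \_ D] <= z%:E)%E ->
  (\int[mu]_(x in D) (`|h x| `^ r)%:E <= (z `^ r)%:E)%E.
Proof.
move=> r0 z0; rewrite unlock => hz.
have -> : (\int[mu]_(x in D) (`|h x| `^ r)%:E =
    \int[mu]_x (`|((EFin \o h) \_ D) x| `^ r))%E.
  rewrite integral_mkcond; apply: eq_integral => x _.
  rewrite !patchE; case: ifP => _; first by rewrite -poweR_EFin.
  by rewrite abse0 poweR0r// gt_eqF.
set J := (\int[mu]_x _)%E in hz *.
have J0 : (0 <= J)%E by apply: integral_ge0 => x _; exact: poweR_ge0.
have -> : J = ((J `^ r^-1) `^ r)%E.
  by rewrite -poweRrM mulVf ?gt_eqF// poweRe1.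
rewrite -poweR_EFin; apply: gt0_ler_poweR => //; first exact: ltW.
- by rewrite in_itv/= poweR_ge0 leey.
- by rewrite in_itv/= lee_fin z0 leey.
Qed.

End integrals.

(** * The small values *)

Section small_values.
Variables (R : realType) (z r : R).
Hypotheses (z0 : 0 < z) (r1 : 1 <= r).
Local Notation mu := (@lebesgue_measure R).
Local Notation I := (unit_interval R).
Local Notation H := (half_line R).

Let r0 : 0 < r. Proof. exact: lt_le_trans r1. Qed.
Let z40 : 0 < 4 * z. Proof. by rewrite mulr_gt0. Qed.

(** The scale [4 * z] leaves room for the constants of [small_part_mean]. *)
Definition small_part (y : R) : R := (Num.min `|y| z / (4 * z)) `^ r.

Lemma min_norm_ge0 (y : R) : 0 <= Num.min `|y| z.
Proof. by rewrite le_min normr_ge0 ltW. Qed.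

Lemma measurable_small_part : measurable_fun setT small_part.
Proof.
apply: (measurableT_comp (measurable_powR r)).
apply: measurable_funM; last exact: measurable_cst.
by apply: measurable_minr; [exact: normr_measurable|exact: measurable_cst].
Qed.

Lemma small_part_ge0 y : 0 <= small_part y.
Proof. exact: powR_ge0. Qed.

Lemma small_part_le1 y : small_part y <= 1.
Proof.
rewrite -[leRHS](_ : 1 `^ r = 1); last by rewrite powR1.
apply: ler_powR2; first exact: ltW.
  by rewrite divr_ge0 ?min_norm_ge0 ?ltW.
rewrite ler_pdivrMr// mul1r ge_min; apply/orP; right.
by rewrite ler_peMl ?ler1n// ltW.
Qed.

Lemma lt_small_part u y : 0 <= u ->
  (u < small_part y) = (4 * z * u `^ r^-1 < `|y|) && (4 * z * u `^ r^-1 < z).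
Proof.
move=> u0; rewrite ltr_powR_inv// ?divr_ge0 ?min_norm_ge0 ?(ltW z40)//.
by rewrite ltr_pdivlMr// mulrC lt_min.
Qed.

Lemma small_part_tail (f : nat -> R -> R) F n u :
  (forall k, measurable_fun I (f k)) -> disjointification f F -> 0 <= u ->
  (\sum_(k < n) mu (I `&` [set x | (u < small_part (f k x))%R])
    <= mu (H `&` [set x | (u < small_part (F x))%R]))%E.
Proof.
move=> mf disjF u0.
have a0 : 0 <= 4 * z * u `^ r^-1 by rewrite mulr_ge0 ?powR_ge0 ?ltW.
have e (D : set R) (h : R -> R) : D `&` [set x | u < small_part (h x)] =
    if 4 * z * u `^ r^-1 < z then D `&` [set x | 4 * z * u `^ r^-1 < `|h x|]
    else set0.
  case: ifP => az; apply/seteqP; split => x //=.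
  - by move=> [Dx]; rewrite lt_small_part// => /andP[].
  - by move=> [Dx]; rewrite lt_small_part// az andbT.
  - by move=> [Dx]; rewrite lt_small_part// az andbF.
rewrite e; under eq_bigr do rewrite e.
case: ifP => _; first exact: disjointification_gt.
by rewrite big1.
Qed.

(** The term [min |a| z] is bounded by [z], which turns its [r]-th power into a
    multiple of [|a|]. With a decomposition of [F] into an integrable and an
    [r]-integrable function for [a] and [b], both terms become integrable. *)
Lemma small_part_majorant (a b : R) :
  small_part (a + b) <=
  (2 / (4 * z)) `^ r * (z `^ (r - 1) * `|a| + `|b| `^ r).
Proof.
have m_le : Num.min `|a + b| z <= 2 * Num.max (Num.min `|a| z) `|b|.
  apply: (@le_trans _ _ (Num.min `|a| z + `|b|)); last first.
    by rewrite mulr_natl mulr2n lerD// le_max lexx ?orbT.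
  have := ler_normD a b; case: (leP `|a| z) => za ab.
    by rewrite ge_min ab.
  by rewrite ge_min; apply/orP; right; rewrite lerDl.
rewrite /small_part.
set m := Num.max _ _ in m_le.
have m0 : 0 <= m by rewrite le_max min_norm_ge0.
apply: (@le_trans _ _ ((2 / (4 * z) * m) `^ r)).
  apply: ler_powR2; [exact: ltW|by rewrite divr_ge0 ?min_norm_ge0 ?ltW|].
  by rewrite mulrAC; apply: ler_wpM2r => //; rewrite invr_ge0 ltW.
rewrite powRM ?divr_ge0 ?(ltW z40)//; apply: ler_wpM2l; first exact: powR_ge0.
have min_le : (Num.min `|a| z) `^ r <= z `^ (r - 1) * `|a|.
  rewrite -mulr_powRB1 ?min_norm_ge0// mulrC.
  apply: ler_pM; rewrite ?powR_ge0 ?min_norm_ge0//; last by rewrite ge_min lexx.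
  apply: ler_powR2; rewrite ?subr_ge0 ?min_norm_ge0//.
  by rewrite ge_min lexx orbT.
rewrite /m; case: (leP (Num.min `|a| z) `|b|) => _.
  by rewrite lerDr mulr_ge0// powR_ge0.
by apply: (le_trans min_le); rewrite lerDl powR_ge0.
Qed.

(** The sum over [k] of the tails of the [f k] is a tail of [F]. The sum over [j]
    of these tails is at most [L] times the integral of [small_part F], hence of
    its majorant, and the factor [4] in [small_part] makes that integral at most
    [(2 / (4 z)) ^ r * 2 * z ^ r = 2 * 2 ^ (- r) <= 1]. *)
Lemma small_part_mean (f : nat -> R -> R) F n L :
  (forall k, measurable_fun I (f k)) -> disjointification f F ->
  (L1_plus_Lq_norm H r%:E F < z%:E)%E -> (0 < L)%N ->
  (\sum_(k < n) \sum_(j < L)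
    mu (I `&` [set x | (j.+1%:R * L%:R^-1 < small_part (f k x))%R])
    <= L%:R%:E)%E.
Proof.
move=> mf disjF /ereal_inf_lt[_ [[g h] /= [mg mh Fgh] <-] ghz] L0.
have LR : 0 < L%:R :> R by rewrite ltr0n.
have LV0 : 0 <= L%:R^-1 :> R by rewrite invr_ge0 ltW.
have mH := @measurable_half_line R.
have ng : ('N[mu]_1[(EFin \o g) \_ H] <= z%:E)%E.
  by apply: le_trans (ltW ghz); rewrite leeDl// Lnorm_ge0.
have nh : ('N[mu]_r%:E[(EFin \o h) \_ H] <= z%:E)%E.
  by apply: le_trans (ltW ghz); rewrite leeDr// Lnorm_ge0.
have intg := integral_powR_le ltr01 (ltW z0) ng.
have inth := integral_powR_le r0 (ltW z0) nh.
pose C := (2 / (4 * z)) `^ r.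
pose Psi x := C * (z `^ (r - 1) * `|g x| + `|h x| `^ r).
have C0 : 0 <= C by exact: powR_ge0.
have Psi0 x : 0 <= Psi x.
  by rewrite mulr_ge0// addr_ge0 ?mulr_ge0 ?powR_ge0.
have mng : measurable_fun H (fun x => `|g x|) by exact: measurableT_comp.
have mnh : measurable_fun H (fun x => `|h x| `^ r).
  apply: (measurableT_comp (measurable_powR r)); exact: measurableT_comp.
have mPsi : measurable_fun H Psi.
  apply: measurable_funM; first exact: measurable_cst.
  apply: measurable_funD => //; apply: measurable_funM => //.
have mF := proj1 disjF.
apply: (@le_trans _ _ (\sum_(j < L)
    mu (H `&` [set x | (j.+1%:R * L%:R^-1 < Psi x)%R]))%E).
  rewrite exchange_big/=; apply: lee_sum => j _.
  apply: le_trans (small_part_tail n mf disjF _) _; first by rewrite mulr_ge0.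
  apply: le_measure; rewrite ?inE.
  - apply: measurable_gt_const => //.
    by apply: measurableT_comp => //; exact: measurable_small_part.
  - exact: measurable_gt_const.
  - move=> x [Hx /= sx]; split=> //=; apply: (lt_le_trans sx).
    by rewrite Fgh//; exact: small_part_majorant.
have := tail_sum_le_integral mu mH L mPsi (fun x _ => Psi0 x) LV0.
have intPsi : (\int[mu]_(x in H) (Psi x)%:E <= 1%:E)%E.
  under eq_integral do rewrite EFinM EFinD EFinM.
  have mg' : measurable_fun H (fun x => `|g x|%:E) by exact/measurable_EFinP.
  have mzg : measurable_fun H (fun x => (z `^ (r - 1))%:E * `|g x|%:E)%E.
    exact: emeasurable_funM.
  have mh' : measurable_fun H (fun x => (`|h x| `^ r)%:E) by exact/measurable_EFinP.
  have g0 x : H x -> (0 <= (z `^ (r - 1))%:E * `|g x|%:E)%E.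
    by move=> _; rewrite mule_ge0 ?lee_fin ?powR_ge0.
  have h0 x : H x -> (0 <= (`|h x| `^ r)%:E)%E.
    by move=> _; rewrite lee_fin powR_ge0.
  have msum := emeasurable_funD mzg mh'.
  have sum0 x : H x -> (0 <= (z `^ (r - 1))%:E * `|g x|%:E + (`|h x| `^ r)%:E)%E.
    by move=> Hx; rewrite adde_ge0 ?g0 ?h0.
  rewrite ge0_integralZl// ge0_integralD// ge0_integralZl ?lee_fin ?powR_ge0//.
  apply: (@le_trans _ _ (C%:E * ((z `^ (r - 1))%:E * (z `^ 1)%:E + (z `^ r)%:E))%E).
    apply: lee_wpmul2l => //; apply: leeD => //.
    apply: lee_wpmul2l; first by rewrite lee_fin powR_ge0.
    apply: le_trans intg; rewrite le_eqVlt; apply/orP; left; apply/eqP.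
    by apply: eq_integral => x _; rewrite powRr1.
  rewrite -!EFinM lee_fin (powRr1 (ltW z0)) [z `^ (r - 1) * z]mulrC.
  rewrite mulr_powRB1// ?(ltW z0)// -mulr2n -mulr_natr mulrA /C.
  rewrite -powRM ?divr_ge0 ?(ltW z40) ?(ltW z0)//.
  have -> : 2 / (4 * z) * z = 2^-1 by field; rewrite gt_eqF.
  rewrite -ler_pdivlMr// mul1r.
  by have := @ge1r_powR _ (2^-1 : R) r; apply => //; rewrite invr_gt0 ltr0n invf_le1// ler1n.
move=> /le_trans/(_ intPsi) => hL.
rewrite -(@lee_pmul2l _ (L%:R^-1)%:E)//; last by rewrite lte_fin invr_gt0.
by rewrite -EFinM mulVf ?gt_eqF.
Qed.

End small_values.

(** * The estimate *)

Section estimate.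
Variables (R : realType) (P : probability (sequence_space R) R).
Variable B : nat -> set R.
Hypotheses (HP : is_product_measure P) (HB : kruglov_sets B).
Local Notation mu := (@lebesgue_measure R).
Local Notation I := (unit_interval R).
Local Notation H := (half_line R).
Variables X Y : symmetric_space I.
Hypothesis XY : ss_mem X `<=` ss_mem Y.
Hypothesis Kfin : (kruglov_norm P B X Y < +oo)%E.
Local Notation kappa := (fine (kruglov_norm P B X Y)).
Local Notation c := (fine (inclusion_norm X Y)).
Variables (f : nat -> R -> R) (F : R -> R) (z : R).
Hypotheses (Xf : forall k, ss_mem X (f k)) (indf : independent_rvs f).
Hypotheses (disjF : disjointification f F) (z0 : 0 < z).
Hypothesis Fz : (ext_norm X ((rearrangement mu H F) \_ I) < z%:E)%E.
Local Notation V := (fine \o rearrangement mu H F).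
Local Notation g k := (large_part z \o f k).

Let mf k : measurable_fun I (f k). Proof. exact: ss_measurable (Xf k). Qed.
Let mg k : measurable_fun I (g k).
Proof. by apply: measurableT_comp => //; exact: measurable_large_part. Qed.

Lemma ss_norm_sum_large n :
  ss_mem Y (fun x => \sum_(k < n) g k x) /\
  ss_norm Y (fun x => \sum_(k < n) g k x) <= 8 * z * kappa.
Proof.
have [XV Vz] := ss_rearrangement Fz.
have msum : measurable_fun I (fun x => \sum_(k < n) g k x).
  by apply: measurable_sum => k; exact: mg.
have -> : 8 * z * kappa = 4 * 2 * z * kappa by ring.
apply: (ss_le_kruglov HB Kfin XV z0 (ltW Vz) msum) => // s s0.
apply: (@sum_tail_le_kruglov _ _ _ HP HB (fun k => g k)) => //.
- by apply: independent_rvs_comp => //; exact: measurable_large_part.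
- by move=> k x _; exact: large_part_ge0.
- exact: ss_measurable XV.
- by move=> x _; exact: rearrangement_ge0_fine.
- by move=> a b a0; exact: (large_part_cell (proj1 disjF) z0 Fz).
Qed.

Lemma measurable_bigmax n (h : nat -> R -> R) :
  (forall k, measurable_fun I (h k)) ->
  measurable_fun I (fun x => \big[Num.max/0]_(k < n) h k x).
Proof.
elim: n h => [|n ih] h mh.
  rewrite (_ : (fun x => _) = fun=> 0); first exact: measurable_cst.
  by apply/funext => x; rewrite big_ord0.
rewrite (_ : (fun x => _) =
    (fun x => Num.max (h 0%N x) (\big[Num.max/0]_(k < n) h k.+1 x))).
  by apply: measurable_maxr => //; apply: (ih (fun k => h k.+1)).
by apply/funext => x; rewrite big_ord_recl.
Qed.

(** The maximum exceeds a level only if some [g k] does, and the sum of these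
    tails is a tail of [V]. The bound thus holds in [X], and the inclusion
    carries it to [Y]. *)
Lemma ss_norm_max_large n :
  ss_mem Y (fun x => \big[Num.max/0]_(k < n) g k x) /\
  ss_norm Y (fun x => \big[Num.max/0]_(k < n) g k x) <= c * z.
Proof.
have [XV Vz] := ss_rearrangement Fz.
have mmax := measurable_bigmax n mg.
have max0 x : 0 <= \big[Num.max/0]_(k < n) g k x by exact: bigmax_ge_id.
suff [Xmax nmax] : ss_mem X (fun x => \big[Num.max/0]_(k < n) g k x) /\
    ss_norm X (fun x => \big[Num.max/0]_(k < n) g k x) <= ss_norm X V.
  exact: (ss_norm_inclusion HP HB XY Kfin Xmax z0 (le_trans nmax (ltW Vz))).
apply: ss_le => // s s0.
have cellE (h : R -> R) x : 0 <= h x -> (cell s +oo (h x)) = (s < `|h x|).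
  move=> h0; rewrite ger0_norm//; apply/propext; split; first by case.
  by move=> sh; split=> //; rewrite leey.
have -> : distribution_function mu I V s = mu (I `&` V @^-1` cell s +oo).
  congr (mu (_ `&` _)); apply/seteqP; split => x /=;
  by rewrite -[cell s _ _]/(cell s +oo (V x)) cellE ?rearrangement_ge0_fine.
apply: le_trans _ (large_part_cell (proj1 disjF) z0 Fz n +oo mf disjF s0).
have mcell k : measurable (I `&` g k @^-1` cell s +oo).
  by apply: mg; [exact: measurable_unit_interval|exact: measurable_cell].
apply: le_trans _ (measure_le_sum mu _ (fun (k : 'I_n) _ => mcell k)).
apply: le_measure; rewrite ?inE.
- exact: measurable_gt_unit.
- by apply: bigsetU_measurable => k _; exact: mcell.
move=> x [Ix /=]; rewrite ger0_norm; last exact: max0.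
move=> sx; rewrite -bigcup_seq_cond.
have [k sk] : exists k : 'I_n, s < g k x.
  apply: contrapT => /forallNP sg; move: sx; apply/negP; rewrite -leNgt.
  apply: bigmax_le; first exact: ltW.
  by move=> k _; rewrite leNgt; apply/negP; exact: sg.
exists k; first by rewrite /= mem_index_enum.
by split=> //=; split=> //; rewrite leey.
Qed.

Lemma lq_sum_infty n :
  ss_mem Y (lq_sum +oo f n) /\ ss_norm Y (lq_sum +oo f n) <= 2 * c * z.
Proof.
have c1 := inclusion_ge1 HP HB Kfin.
have [Yv nv] := ss_norm_max_large n.
have [Y1 n1] := ss_cst Y z.
have [YD nD] := ss_add_le Y1 Yv n1 nv.
have mlq : measurable_fun I (lq_sum +oo f n).
  apply: (@measurable_bigmax n (fun k x => `|f k x|)) => k.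
  exact: measurableT_comp.
have [Ylq nlq] : ss_mem Y (lq_sum +oo f n) /\ ss_norm Y (lq_sum +oo f n) <=
    ss_norm Y ((fun=> z) \+ (fun x => \big[Num.max/0]_(k < n) g k x)).
  apply: ss_norm_le => // x Ix /=.
  have v0 : 0 <= \big[Num.max/0]_(k < n) g k x by exact: bigmax_ge_id.
  rewrite !ger0_norm; [|by rewrite addr_ge0// ltW|exact: bigmax_ge_id].
  apply: bigmax_le; first by rewrite addr_ge0// ltW.
  move=> k _; case: (leP `|f k x| z) => fz.
    by apply: (le_trans fz); rewrite lerDl.
  rewrite -[leLHS]add0r lerD//; first exact: ltW.
  apply: le_trans (le_bigmax _ _ k).
  by rewrite /= /large_part fz.
split=> //; apply: (le_trans nlq); apply: (le_trans nD).
rewrite gtr0_norm// -mulrA [2 * _]mulr_natl mulr2n lerD2r.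
by rewrite ler_peMl// ltW.
Qed.

Section finite_exponent.
Variable r : R.
Hypothesis r1 : 1 <= r.
Hypothesis LFz : (L1_plus_Lq_norm H r%:E F < z%:E)%E.
Local Notation theta := (r^-1).

Let r0 : 0 < r. Proof. exact: lt_le_trans r1. Qed.
Let theta01 : 0 <= theta <= 1.
Proof. by rewrite invr_ge0 (ltW r0) invf_le1. Qed.

Lemma ss_norm_sum_small n :
  ss_mem Y (fun x => \sum_(k < n) small_part z r (f k x)) /\
  ss_norm Y (fun x => \sum_(k < n) small_part z r (f k x)) <= 28 * kappa.
Proof.
have msmall k : measurable_fun I (small_part z r \o f k).
  by apply: measurableT_comp => //; exact: measurable_small_part.
have msum : measurable_fun I (fun x => \sum_(k < n) small_part z r (f k x)).
  by apply: measurable_sum => k; exact: msmall.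
have X1 := ss_mem_unit X.
have n1 : ss_norm X (\1_`]0, 1[ : R -> R) <= 1 by rewrite ss_norm_unit.
have -> : 28 * kappa = 4 * 7 * 1 * kappa by ring.
apply: (ss_le_kruglov HB Kfin X1 ltr01 n1 msum) => // s s0.
apply: (@bounded_sum_tail_le_kruglov _ _ _ HP HB
  (fun k => small_part z r \o f k)) => //.
- by apply: independent_rvs_comp => //; exact: measurable_small_part.
- by move=> k x _; rewrite /= small_part_ge0 small_part_le1.
- by move=> L L0; exact: (small_part_mean z0 r1 n mf disjF LFz).
Qed.

(** The exponent [theta] interpolates: [\sum g ^ r <= (max g) ^ (r - 1) * \sum g]
    for the large values, and [zeta ^ theta * 1 ^ (1 - theta)] for the small
    ones. *)
Lemma lq_sum_le n x : lq_sum r%:E f n x <=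
  2 * (4 * z * (28 * kappa) `^ theta *
         ((28 * kappa)^-1 * (\sum_(k < n) small_part z r (f k x)) + 1)
     + (c * z) `^ (1 - theta) * (8 * z * kappa) `^ theta *
         ((c * z)^-1 * (\big[Num.max/0]_(k < n) g k x)
          + (8 * z * kappa)^-1 * (\sum_(k < n) g k x))).
Proof.
have c1 := inclusion_ge1 HP HB Kfin.
have c0 : 0 < c by exact: lt_le_trans c1.
have k0 := kruglov_norm_gt0 HP HB Kfin.
set u := \sum_(k < n) g k x; set v := \big[Num.max/0]_(k < n) g k x.
set zeta := \sum_(k < n) small_part z r (f k x).
have g0 k : 0 <= g k x by exact: large_part_ge0.
have u0 : 0 <= u by apply: sumr_ge0.
have v0 : 0 <= v by exact: bigmax_ge_id.
have zeta0 : 0 <= zeta by apply: sumr_ge0 => k _; exact: small_part_ge0.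
have gr k : 0 <= (g k x) `^ r by exact: powR_ge0.
have z40 : 0 < 4 * z by rewrite mulr_gt0.
have fr (k : 'I_n) : `|f k x| `^ r <=
    (4 * z) `^ r * small_part z r (f k x) + (g k x) `^ r.
  rewrite /small_part -powRM ?divr_ge0 ?min_norm_ge0 ?(ltW z40)//.
  rewrite mulrC divfK ?gt_eqF//= /large_part.
  by case: (ltP z `|f k x|) => zf; rewrite ?lerDr ?lerDl ?powR_ge0.
have sum_fr : \sum_(k < n) `|f k x| `^ r <=
    (4 * z) `^ r * zeta + \sum_(k < n) (g k x) `^ r.
  by rewrite mulr_sumr -big_split; apply: ler_sum => k _; exact: fr.
have sum_gr : \sum_(k < n) (g k x) `^ r <= v `^ (r - 1) * u.
  rewrite mulr_sumr; apply: ler_sum => k _.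
  rewrite -(mulr_powRB1 (g0 k) r0) mulrC; apply: ler_wpM2r => //.
  by apply: ler_powR2; rewrite ?subr_ge0//; exact: le_bigmax.
have sg0 : 0 <= \sum_(k < n) (g k x) `^ r by apply: sumr_ge0.
have zz0 : 0 <= (4 * z) `^ r * zeta by rewrite mulr_ge0 ?powR_ge0.
apply: (@le_trans _ _ (((4 * z) `^ r * zeta + \sum_(k < n) (g k x) `^ r) `^ theta)).
  apply: ler_powR2 => //; first by case/andP: theta01.
  by apply: sumr_ge0 => k _; exact: powR_ge0.
apply: (le_trans (powRD_le zz0 sg0 theta01)).
rewrite ler_pM2l//; apply: lerD.
  rewrite powRM ?powR_ge0// powRVK ?(ltW z40)// -[leRHS]mulrA.
  rewrite ler_pM2l//.
  have A0 : 0 < 28 * kappa by rewrite mulr_gt0.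
  have {1}-> : zeta = 28 * kappa * ((28 * kappa)^-1 * zeta).
    by rewrite mulrA divff ?mul1r ?gt_eqF.
  have t0 : 0 <= (28 * kappa)^-1 * zeta by rewrite mulr_ge0// invr_ge0 ltW.
  rewrite powRM ?(ltW A0)//; apply: ler_wpM2l; first exact: powR_ge0.
  exact: powR_le_add1.
have A0 : 0 < 8 * z * kappa by rewrite !mulr_gt0.
have B0 : 0 < c * z by rewrite mulr_gt0.
apply: (@le_trans _ _ ((v `^ (r - 1) * u) `^ theta)).
  by apply: ler_powR2 => //; case/andP: theta01.
have rtheta : (r - 1) * theta = 1 - theta.
  by rewrite mulrBl mul1r divff ?gt_eqF.
rewrite powRM ?powR_ge0// -powRrM rtheta.
have vE : v = c * z * ((c * z)^-1 * v) by rewrite mulrA divff ?mul1r ?gt_eqF.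
have uE : u = 8 * z * kappa * ((8 * z * kappa)^-1 * u).
  by rewrite mulrA divff ?mul1r ?gt_eqF.
have s0 : 0 <= (c * z)^-1 * v by rewrite mulr_ge0// invr_ge0 ltW.
have t0 : 0 <= (8 * z * kappa)^-1 * u by rewrite mulr_ge0// invr_ge0 ltW.
rewrite {1}vE {1}uE (powRM _ (ltW B0) s0) (powRM _ (ltW A0) t0) mulrACA.
apply: ler_wpM2l; first by rewrite mulr_ge0 ?powR_ge0.
exact: powRM_le_add.
Qed.

(** The four functions of the pointwise bound, divided by the bounds on their
    norms, have norm at most [1]. *)
Lemma lq_sum_finite n : ss_mem Y (lq_sum r%:E f n) /\
  ss_norm Y (lq_sum r%:E f n) <= 480 * c * kappa `^ theta * z.
Proof.
have c1 := inclusion_ge1 HP HB Kfin.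
have c0 : 0 < c by exact: lt_le_trans c1.
have k0 := kruglov_norm_gt0 HP HB Kfin.
have [/ltW th0 th1] : 0 < theta /\ theta <= 1.
  by case/andP: theta01 => _ ->; rewrite invr_gt0.
have A10 : 0 < 28 * kappa by rewrite mulr_gt0.
have A0 : 0 < 8 * z * kappa by rewrite !mulr_gt0.
have B0 : 0 < c * z by rewrite mulr_gt0.
pose A1 := 4 * z * (28 * kappa) `^ theta.
pose A2 := (c * z) `^ (1 - theta) * (8 * z * kappa) `^ theta.
have A10' : 0 <= A1 by rewrite !mulr_ge0 ?powR_ge0// ltW.
have A20 : 0 <= A2 by rewrite mulr_ge0 ?powR_ge0.
have unit_le (a b : R) : 0 < a -> b <= a -> a^-1 * b <= 1.
  by move=> a0 ba; rewrite ler_pdivrMl// mulr1.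
have scale1 h (a : R) : 0 < a -> ss_mem Y h /\ ss_norm Y h <= a ->
    ss_mem Y (a^-1 \*o h) /\ ss_norm Y (a^-1 \*o h) <= 1.
  move=> a0 [Yh ha]; have aV0 : 0 <= a^-1 by rewrite invr_ge0 ltW.
  have [Yah nah] := ss_scale_le aV0 Yh ha; split=> //.
  by apply: (le_trans nah); exact: unit_le.
have [Y1 n1] := scale1 _ _ A10 (ss_norm_sum_small n).
have [Y2 n2] := scale1 _ _ B0 (ss_norm_max_large n).
have [Y3 n3] := scale1 _ _ A0 (ss_norm_sum_large n).
have [Y0] := ss_cst Y 1; rewrite normr1 => n0.
have [Y10 n10] := ss_add_le Y1 Y0 n1 n0.
have [Y23 n23] := ss_add_le Y2 Y3 n2 n3.
have [YL nL] := ss_scale_le A10' Y10 n10.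
have [YR nR] := ss_scale_le A20 Y23 n23.
have [YS nS] := ss_add_le YL YR nL nR.
have [YD nD] := ss_scale_le (ler0n R 2) YS nS.
have mlq : measurable_fun I (lq_sum r%:E f n).
  apply: (measurableT_comp (measurable_powR _)).
  apply: measurable_sum => k; apply: (measurableT_comp (measurable_powR _)).
  exact: measurableT_comp.
set D := (2 \*o _) in YD nD.
have [Ylq nlq] : ss_mem Y (lq_sum r%:E f n) /\
    ss_norm Y (lq_sum r%:E f n) <= ss_norm Y D.
  apply: ss_norm_le => // x Ix; rewrite ger0_norm; last exact: powR_ge0.
  exact: le_trans (lq_sum_le n x) (ler_norm _).
split=> //; apply: (le_trans nlq); apply: (le_trans nD).
have a_theta (a : R) : 1 <= a -> a `^ theta <= a by move=> a1; exact: ler1_powR.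
have A1_le : A1 <= 112 * c * kappa `^ theta * z.
  rewrite /A1 powRM ?(ltW k0)//.
  have kz0 : 0 <= kappa `^ theta * z by rewrite mulr_ge0 ?powR_ge0 ?ltW.
  rewrite (_ : 4 * z * _ = 4 * 28 `^ theta * (kappa `^ theta * z)); last by ring.
  rewrite -[leRHS]mulrA; apply: ler_wpM2r => //.
  apply: (@le_trans _ _ (4 * 28)); first by rewrite ler_pM2l// a_theta// ler1n.
  rewrite -natrM -[leLHS]mulr1; apply: ler_pM => //.
have A2_le : A2 <= 8 * c * kappa `^ theta * z.
  rewrite /A2 !powRM ?(ltW k0) ?(ltW z0) ?(ltW c0) ?mulr_ge0 ?(ltW z0)//.
  have zE : z `^ (1 - theta) * z `^ theta = z.
    by rewrite -powRD ?subrK ?powRr1 ?(ltW z0)// gt_eqF// implybT.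
  rewrite (_ : _ * _ = 8 `^ theta * c `^ (1 - theta) * kappa `^ theta *
    (z `^ (1 - theta) * z `^ theta)); last by ring.
  rewrite zE; apply: ler_wpM2r; first exact: ltW.
  apply: ler_wpM2r; first exact: powR_ge0.
  apply: ler_pM; rewrite ?powR_ge0// ?a_theta ?ler1n//.
  by apply: ler1_powR => //; rewrite gerBl.
have -> : 480 * c * kappa `^ theta * z =
    2 * (112 * c * kappa `^ theta * z * (1 + 1) +
         8 * c * kappa `^ theta * z * (1 + 1)) by ring.
by rewrite ler_pM2l// lerD// ler_wpM2r.
Qed.

End finite_exponent.
End estimate.

Theorem theorem2 (R : realType) :
  exists beta : \bar R -> R, (forall c, 0 < beta c) /\
  forall (P : probability (sequence_space R) R) (B : nat -> set R),
    is_product_measure P -> kruglov_sets B ->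
  forall X Y : symmetric_space (unit_interval R),
    ss_mem X `<=` ss_mem Y ->
    (kruglov_norm P B X Y < +oo)%E ->
  forall f : nat -> R -> R,
    (forall k, ss_mem X (f k)) -> independent_rvs f ->
  forall F : R -> R, disjointification f F ->
  forall q : \bar R, (1 <= q)%E ->
    (Ylq_norm Y q f
      <= (beta (inclusion_norm X Y))%:E
         * kruglov_norm P B X Y `^ fine q^-1 * Z_norm X q F)%E.
Proof.
exists (fun c => 480 * (1 + `|fine c|)); split.
  by move=> c; rewrite mulr_gt0// ltr_pwDl.
move=> P B HP HB X Y XY Kfin f Xf indf F disjF q q1.
have c1 := inclusion_ge1 HP HB Kfin.
have k0 := kruglov_norm_gt0 HP HB Kfin.
rewrite (kruglov_norm_fin Kfin) poweR_EFin.
set c := fine (inclusion_norm X Y) in c1 *.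
set kappa := fine (kruglov_norm P B X Y) in k0 *.
have extZ : (0 <= ext_norm X ((rearrangement lebesgue_measure (half_line R) F)
    \_ (unit_interval R)))%E by exact: ext_norm_ge0.
have LZ : (0 <= L1_plus_Lq_norm (half_line R) q F)%E.
  apply: le_ereal_inf_tmp => _ [gh _ <-].
  by rewrite adde_ge0// Lnorm_ge0.
have ZE z : (Z_norm X q F < z%:E)%E ->
    (ext_norm X ((rearrangement lebesgue_measure (half_line R) F)
      \_ (unit_interval R)) < z%:E)%E /\
    (L1_plus_Lq_norm (half_line R) q F < z%:E)%E.
  by move=> Zz; split; apply: le_lt_trans Zz; [rewrite leeDl|rewrite leeDr].
have key z n : 0 < z -> (Z_norm X q F < z%:E)%E ->
    (ext_norm Y (EFin \o lq_sum q f n) <=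
     (480 * (1 + `|c|) * kappa `^ fine q^-1 * z)%:E)%E.
  move=> z0 /ZE[extz Lz]; apply: ext_norm_le.
  have cc : c <= 1 + `|c| by apply: (le_trans (ler_norm _)); rewrite lerDr.
  case: q q1 Lz {LZ ZE} => [r| |]// q1 Lz; last first.
    have [Yq nq] := lq_sum_infty HP HB XY Kfin Xf disjF z0 extz n.
    split=> //; apply: (le_trans nq); rewrite invey /= powRr0 mulr1.
    apply: ler_wpM2r; first exact: ltW.
    by apply: ler_pM => //; [exact: le_trans c1|rewrite ler_nat].
  rewrite lee_fin in q1.
  have [Yq nq] := lq_sum_finite HP HB XY Kfin Xf indf disjF z0 extz q1 Lz n.
  split=> //; apply: (le_trans nq); rewrite fine_invr.
  apply: ler_wpM2r; first exact: ltW.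
  apply: ler_wpM2r; first exact: powR_ge0.
  by rewrite ler_pM2l.
apply: ge_ereal_sup => _ [n _ <-].
have bk0 : 0 < 480 * (1 + `|c|) * kappa `^ fine q^-1.
  by rewrite !mulr_gt0 ?powR_gt0// ltr_pwDl.
have Z0 : (0 <= Z_norm X q F)%E by rewrite adde_ge0.
case EZ : (Z_norm X q F) Z0 => [zz| |]//; last first.
  by move=> _; rewrite -EFinM gt0_muley ?lte_fin// leey.
rewrite lee_fin => zz0; rewrite -!EFinM.
apply/lee_addgt0Pr => e e0.
pose b := 480 * (1 + `|c|) * kappa `^ fine q^-1.
have eb0 : 0 < e / b by rewrite divr_gt0.
have := key (zz + e / b) n.+1 (ltr_wpDl zz0 eb0) _.
rewrite EZ lte_fin ltrDl eb0 => /(_ isT) h; apply: le_trans h _.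
by rewrite -EFinD lee_fin -/b mulrDr [b * (e / b)]mulrC divfK ?gt_eqF.
Qed.
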